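(* Consider a FCFS $M/GI/n$ queue with Markovian (exponentially distributed) inter-arrival times distributed as $A$, and service times distributed as $S$ satisfying $\mathbb{E}[S] < \infty$. Suppose also that $\mu_A < n\mu_S$, and that $Q(\infty)$ and $\overline{W}_{\mathrm{service}}(\infty)$ exist. Then for all $x \in \Big(0, \frac{n - \frac{\mu_A}{\mu_S}}{\sqrt{\frac{\mu_A}{\mu_S}}}\Big]$, $$\mathbb{P}\Big(\mathrm{Num}_{\mathrm{service}}(\infty) \geq \frac{\mu_A}{\mu_S} + x\sqrt{\frac{\mu_A}{\mu_S}}\Big) \leq \frac{1}{2x}.$$
   Context: A FCFS $M/GI/n$ queue has $n \ge 1$ identical servers and an infinite waiting room; inter-arrival times are i.i.d. distributed as the exponential random variable $A$ (Poisson arrivals of rate $\mu_A$), service times are i.i.d. distributed as the non-negative random variable $S$ with $\mathbb{E}[S] > 0$, the two sequences are independent, and jobs are served first-come-first-serve. For a random variable $X$, $\mu_X = 1/\mathbb{E}[X]$. ''$Q(\infty)$ exists'' means that the total number of jobs in the system (in service plus waiting in queue) converges in distribution as time tends to infinity, independently of the particular initial condition, to a random variable $Q(\infty)$. ''$\overline{W}_{\mathrm{service}}(\infty)$ exists'' means that the (sorted) vector of residual service times of the jobs currently in service converges in distribution, independently of the initial condition, to a random vector $\overline{W}_{\mathrm{service}}(\infty)$. $\mathrm{Num}_{\mathrm{service}}(\infty)$ is the corresponding steady-state number of jobs in service, i.e. the number of non-zero components of $\overline{W}_{\mathrm{service}}(\infty)$. *)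

(* Defs.v *)
From HB Require Import structures.
From mathcomp Require Import all_boot all_order all_algebra finmap.
From mathcomp Require Import all_classical all_reals all_analysis.
Export numFieldNormedType.Exports.

Set Implicit Arguments.
Unset Strict Implicit.
Unset Printing Implicit Defensive.

Import Order.TTheory GRing.Theory Num.Theory.
Local Open Scope classical_set_scope.
Local Open Scope ring_scope.

(* The rate mu_X = 1 / E[X]; only meaningful when 0 < E[X] < +oo. *)
Definition rate d (T : measurableType d) (R : realType) (P : probability T R)
  (X : T -> R) : R := (fine 'E_P[X]%E)^-1.

(* The laws are compared on measurable sets only: the value of a measure on
   other sets is unspecified. *)
Definition same_law d (T : measurableType d) (R : realType)
    (P : probability T R) (X Y : {RV P >-> R}) : Prop :=
  forall B : set R, measurable B -> distribution P X B = distribution P Y B.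

Definition exponentially_distributed d (T : measurableType d) (R : realType)
    (P : probability T R) (X : {RV P >-> R}) : Prop :=
  exists2 lambda : R, 0 < lambda &
    forall B : set R, measurable B ->
      distribution P X B = exponential_prob lambda B.

Definition mutually_independent d (T : measurableType d) (R : realType)
    (P : probability T R) (I : eqType) (X : I -> {RV P >-> R}) : Prop :=
  forall (J : seq I) (B : I -> set R), uniq J ->
    (forall i, measurable (B i)) ->
    fine (P (\bigcap_(i in [set` J]) (X i @^-1` B i))) =
    \prod_(i <- J) fine (P (X i @^-1` B i)).

(* Independence within each sequence and between the two sequences. *)
Definition independent_sequences d (T : measurableType d) (R : realType)
    (P : probability T R) (X Y : nat -> {RV P >-> R}) : Prop :=
  mutually_independent
    (fun i : nat + nat => match i with inl k => X k | inr k => Y k end).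

(* Convergence in distribution of X t to Y as t -> +oo; X and Y may live on
   different probability spaces. *)
Definition cvg_in_distribution (R : realType) d (T : measurableType d)
    (P : probability T R) d' (T' : measurableType d') (P' : probability T' R)
    (E : topologicalType) (X : R -> T -> E) (Y : T' -> E) : Prop :=
  forall f : E -> R, continuous f -> (exists M, forall e, `|f e| <= M) ->
    'E_P[f \o X t]%E @[t --> +oo] --> 'E_P'[f \o Y]%E.

(* State at time 0: the residual service times of the jobs in service, and the
   number of jobs waiting in queue (none unless all servers are busy). *)
Record initial_condition (R : realType) (n : nat) := InitialCondition {
  init_residuals : seq R;
  init_waiting : nat;
  init_residuals_gt0 : all (fun r => 0 < r) init_residuals;
  init_residuals_size : (size init_residuals <= n)%N;
  init_work_conserving :
    (0 < init_waiting)%N -> size init_residuals = n }.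

Section sample_path.
Variables (R : realType) (n : nat) (init : initial_condition R n).
(* a i: i-th inter-arrival time; s j: j-th service time *)
Variables (a s : nat -> R).

(* Jobs are numbered in order of arrival, starting with those in service at
   time 0, followed by those waiting at time 0.  Both kinds count as arriving
   at time 0 in an empty system; the service time of the former is their
   residual service time. *)
Definition init_jobs : nat := (size (init_residuals init) + init_waiting init)%N.

(* The sum is empty for the jobs k < init_jobs (truncated subtraction). *)
Definition arrival_time (k : nat) : R := \sum_(i < k.+1 - init_jobs) a i.

Definition service_time (k : nat) : R :=
  if (k < size (init_residuals init))%N then nth 0 (init_residuals init) k
  else s (k - size (init_residuals init))%N.

(* server_free k: the times, in increasing order, at which the n servers have
   completed all the jobs of index < k assigned to them.  Job k goes to the
   server that is available first (Kiefer-Wolfowitz recursion). *)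
Fixpoint server_free (k : nat) : seq R :=
  match k with
  | 0%N => nseq n 0
  | j.+1 =>
      let c := server_free j in
      sort <=%R
        (Num.max (arrival_time j) (head 0 c) + service_time j :: behead c)
  end.

Definition start_time (k : nat) : R :=
  Num.max (arrival_time k) (head 0 (server_free k)).

Definition departure_time (k : nat) : R := start_time k + service_time k.

(* fset_set is the empty set on infinite sets; the sets below are almost surely
   finite for a non-degenerate arrival process. *)
Definition jobs_in_system (t : R) : {fset nat} :=
  fset_set [set k | arrival_time k <= t < departure_time k].

Definition jobs_in_service (t : R) : {fset nat} :=
  fset_set [set k | start_time k <= t < departure_time k].

Definition num_in_system (t : R) : nat := #|` jobs_in_system t|%fset.

(* Residual service times in decreasing order, padded with zeros for the idle
   servers (by the default value of nth). *)
Definition service_vector (t : R) : 'rV[R]_n :=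
  \row_(i < n)
    nth 0 (sort >=%R [seq departure_time k - t | k <- jobs_in_service t]) i.

End sample_path.

(* Q(oo) exists, and Qoo has its distribution. *)
Definition steady_state_num_in_system (R : realType) (n : nat)
    d (T : measurableType d) (P : probability T R)
    (interarrival service : nat -> {RV P >-> R})
    d' (T' : measurableType d') (P' : probability T' R)
    (Qoo : {RV P' >-> nat}) : Prop :=
  forall init : initial_condition R n,
    cvg_in_distribution P P'
      (fun t w =>
         num_in_system init (fun i => interarrival i w) (service ^~ w) t)
      Qoo.

Definition random_vector (R : realType) (n : nat)
    d (T : measurableType d) (P : probability T R)
    (Y : 'I_n -> {RV P >-> R}) (w : T) : 'rV[R]_n := \row_(i < n) Y i w.

(* W_service(oo) exists, and the random vector Woo has its distribution. *)
Definition steady_state_service_vector (R : realType) (n : nat)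
    d (T : measurableType d) (P : probability T R)
    (interarrival service : nat -> {RV P >-> R})
    d' (T' : measurableType d') (P' : probability T' R)
    (Woo : 'I_n -> {RV P' >-> R}) : Prop :=
  forall init : initial_condition R n,
    cvg_in_distribution P P'
      (fun t w =>
         service_vector init (fun i => interarrival i w) (service ^~ w) t)
      (random_vector Woo).

Definition num_nonzero (R : realType) (n : nat) (v : 'rV[R]_n) : nat :=
  #|[pred i : 'I_n | v ord0 i != 0]|.

(* Main.v *)
Require Import Defs.
From HB Require Import structures.
From mathcomp Require Import all_boot all_order all_algebra finmap.
From mathcomp Require Import all_classical all_reals all_analysis.
From mathcomp Require Import measurable_realfun ring lra zify.

(** The number [N] of busy servers in the steady state is compared with the
    number [M] of jobs in a queue with infinitely many servers, fed by the same
    arrivals and service times.  Put [r = mu_A / mu_S], the offered load.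

    (1) Work conservation gives [E N <= r]: the servers cannot do more work than
    arrives, and work arrives at the rate [r].

    (2) Started from an empty system, [N >= min n M] on every sample path
    ([in_service_ge_unfinished]): either all the servers are busy, or no job
    waits, and then jobs are served just as with infinitely many servers.

    (3) In the limit, [M] is Poisson distributed with mean [r]; only its first
    two moments are needed.  With [c = sqrt r] and
    [z^+ <= (z + c)^2 / (4 * c)] they give
    [E (r - M)^+ <= (r + c^2) / (4 * c) = c / 2].

    Since [r < n], (2) yields [(r - N)^+ <= (r - M)^+], and therefore
    [E (N - r)^+ = E (N - r) + E (r - N)^+ <= c / 2].  Markov's inequality for
    [(N - r)^+] at the level [x * c] is the claim.

    All this is done at a finite time [t] for the system started empty, and then
    carried to the limit law.  The number of nonzero residual service times is
    lower semicontinuous, so its excess over [r] is the increasing limit of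
    bounded continuous functions [smoothed_excess] of the residual vector; it
    suffices to bound the limit of their means, which exists by hypothesis.  The
    inequality [E N <= r] is not available at each time [t], but it holds
    approximately at arbitrarily late times, because the time integral of [E N]
    up to [tau] is at most [r * tau] ([busy_time_total]).  This is enough to
    bound a limit ([limit_excess_le]).

    The moments of [M] are computed without the Poisson law, from the identity
    that characterizes the renewal measure of exponential variables
    ([poisson_intensity_step]): the expected sum of [f] over the arrival times is
    [lam] times the integral of [f].  Applied once it gives the mean
    ([sum_unfinished_prob], [mean_unfinishedE]), and applied after each arrival
    it gives the mean number of pairs ([sum_unfinished_pairs_le]). *)

Import Order.TTheory GRing.Theory Num.Theory.
Set Implicit Arguments.
Unset Strict Implicit.
Unset Printing Implicit Defensive.
Local Open Scope classical_set_scope.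
Local Open Scope ring_scope.

(** * Indicators, Tonelli and changes of variables *)

Local Open Scope ereal_scope.

Section indicators.
Context {R : realType}.

(** The indicator is an extended real, so that probabilities, lengths and
    counts are integrals or sums of one kind of function, and exchanging them is
    always an instance of Tonelli. *)
Definition chi (b : bool) : \bar R := (b%:R)%:E.

Lemma chiE (b : bool) : chi b = if b then 1 else 0.
Proof. by case: b. Qed.

Lemma chi_ge0 (b : bool) : 0 <= chi b.
Proof. by rewrite lee_fin ler0n. Qed.

Lemma chi_and (b c : bool) : chi (b && c) = chi b * chi c.
Proof. by rewrite /chi -EFinM; case: b; case: c; rewrite ?mul1r ?mul0r. Qed.

Lemma le_chi (b c : bool) : (b -> c) -> chi b <= chi c.
Proof. by rewrite lee_fin ler_nat; case: b; case: c => // /(_ isT). Qed.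

Lemma measurable_chi d (T : measurableType d) (b : T -> bool) :
  measurable_fun setT b -> measurable_fun setT (fun w => chi (b w) : \bar R).
Proof.
move=> mb; rewrite (_ : (fun _ => _) = fun w => if b w then 1%E else 0%E).
  exact: measurable_fun_ifT.
by apply/funext => w; rewrite /chi; case: (b w).
Qed.

Lemma measurable_boolset d (T : measurableType d) (b : T -> bool) :
  measurable_fun setT b -> measurable [set w | b w].
Proof. by move=> mb; rewrite -[X in measurable X]setTI;
  exact: (mb _ [set true]). Qed.

Lemma integral_chi d (T : measurableType d) (mu : {measure set T -> \bar R})
    (b : T -> bool) : measurable_fun setT b ->
  \int[mu]_w chi (b w) = mu [set w | b w].
Proof.
move=> mb; rewrite -(setIT [set w | b w]) -integral_indic//.
  by apply: eq_integral => w _; rewrite /chi indicE mem_setE.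
exact: measurable_boolset.
Qed.

Lemma measurable_chi_le d (T : measurableType d) (f g : T -> R) :
  measurable_fun setT f -> measurable_fun setT g ->
  measurable_fun setT (fun w => chi (f w <= g w)%R : \bar R).
Proof. by move=> mf mg; exact/measurable_chi/measurable_fun_ler. Qed.

Lemma measurable_chi_lt d (T : measurableType d) (f g : T -> R) :
  measurable_fun setT f -> measurable_fun setT g ->
  measurable_fun setT (fun w => chi (f w < g w)%R : \bar R).
Proof. by move=> mf mg; exact/measurable_chi/measurable_fun_ltr. Qed.

End indicators.

Lemma integral_probability_cst d (T : measurableType d) (R : realType)
    (P : probability T R) (x : \bar R) : \int[P]_w x = x.
Proof. by rewrite integral_cst// [X in _ * X](@probability_setT _ _ _ P) mule1. Qed.

Lemma tonelli d1 d2 (T1 : measurableType d1) (T2 : measurableType d2)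
    (R : realType) (m1 : {sigma_finite_measure set T1 -> \bar R})
    (m2 : {sigma_finite_measure set T2 -> \bar R}) (f : T1 -> T2 -> \bar R) :
  measurable_fun setT (fun p : T1 * T2 => f p.1 p.2) ->
  (forall x y, 0 <= f x y) ->
  \int[m1]_x \int[m2]_y f x y = \int[m2]_y \int[m1]_x f x y.
Proof.
by move=> mf f0; apply: (fubini_tonelli (fun p : T1 * T2 => f p.1 p.2)) => // -[].
Qed.

Lemma measurable_ge0_integral d1 d2 (T1 : measurableType d1)
    (T2 : measurableType d2) (R : realType)
    (m2 : {sigma_finite_measure set T2 -> \bar R}) (f : T1 -> T2 -> \bar R) :
  measurable_fun setT (fun p : T1 * T2 => f p.1 p.2) ->
  (forall x y, 0 <= f x y) ->
  measurable_fun setT (fun x => \int[m2]_y f x y).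
Proof.
move=> mf f0.
exact: (@measurable_fun_fubini_tonelli_F _ _ _ _ _ m2
  (fun p : T1 * T2 => f p.1 p.2)).
Qed.

Section change_of_variables.
Context {R : realType}.
Notation mu := (@lebesgue_measure R).

Lemma lebesgue_measure_shift (a : R) (A : set R) : measurable A ->
  pushforward mu (fun x : R => (a + x)%R : measurableTypeR R) A = mu A.
Proof.
move=> mA; have ms : measurable_fun [set: measurableTypeR R]
    (fun x : R => (a + x)%R : measurableTypeR R) by exact: measurable_funD.
pose f : {mfun measurableTypeR R >-> measurableTypeR R} :=
  HB.pack (fun x : R => (a + x)%R : measurableTypeR R)
    (isMeasurableFun.Build _ _ _ _ _ ms).
apply/esym.
have := @lebesgue_measure_unique R (pushforward mu f : {measure set
  (measurableTypeR R) -> \bar R}).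
apply => //=.
move=> _ [[b c]] _ <-; rewrite /pushforward /=.
rewrite (_ : _ @^-1` _ = `](b - a)%R, (c - a)%R]%classic).
  rewrite !lebesgue_measure_itv/= !lte_fin ltrD2r -!EFinB.
  by case: ifP => // _; congr (_%:E); ring.
by apply/seteqP; split=> x /=; rewrite !in_itv/= !(ltrBlDl, lerBrDl).
Qed.

Lemma ge0_integral_shift (a : R) (f : R -> \bar R) :
  measurable_fun setT f -> (forall x, 0 <= f x) ->
  \int[mu]_x f (a + x)%R = \int[mu]_x f x.
Proof.
move=> mf f0.
have ms : measurable_fun [set: measurableTypeR R]
    (fun x : R => (a + x)%R : measurableTypeR R) by exact: measurable_funD.
transitivity (\int[pushforward mu
    (fun x : R => (a + x)%R : measurableTypeR R)]_x f x).
  by rewrite (ge0_integral_pushforward ms).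
by apply: eq_measure_integral => A mA _; exact: lebesgue_measure_shift.
Qed.

Lemma integral_below (y : \bar R) : 0 <= y ->
  \int[mu]_u chi ((0 <= u)%R && (u%:E < y)) = y.
Proof.
move=> y0; rewrite integral_chi; last first.
  apply: measurable_and; first exact: measurable_fun_ler.
  exact: measurable_fun_lte.
case: y y0 => [y| |//]; rewrite ?lee_fin => y0.
  rewrite (_ : [set _ | _] = `[0%R, y[%classic).
    rewrite /= lebesgue_measure_itv/= lte_fin.
    by case: ltgtP y0 => // [_ _|<- _]; rewrite ?oppr0 ?adde0.
  by apply/seteqP; split=> x /=; rewrite in_itv/= lte_fin.
rewrite (_ : [set _ | _] = `[0%R, +oo[%classic).
  by rewrite /= lebesgue_measure_itv/= ltry ?oppr0 ?adde0.
by apply/seteqP; split=> x /=; rewrite in_itv/= ltry.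
Qed.

(** By the layer cake formula [integral_below], [f x] is the length of the set
    of [u >= 0] below [f x]; Tonelli then reduces the claim to indicators, for
    which it is the hypothesis on [n]. *)
Lemma ge0_integral_density (n : {sigma_finite_measure set R -> \bar R})
    (g f : R -> \bar R) :
  measurable_fun setT g -> (forall x, 0 <= g x) ->
  (forall A, measurable A -> n A = \int[mu]_(x in A) g x) ->
  measurable_fun setT f -> (forall x, 0 <= f x) ->
  \int[n]_x f x = \int[mu]_x (f x * g x).
Proof.
move=> mg g0 nE mf f0.
pose b (x : R) (u : R) := (0 <= u)%R && (u%:E < f x).
have mb : measurable_fun setT (fun p : R * R => b p.1 p.2).
  apply: measurable_and; first by apply: measurable_fun_ler.
  apply: measurable_fun_lte => //; first exact: measurableT_comp.
  exact: measurableT_comp.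
have mchi : measurable_fun setT (fun p : R * R => chi (b p.1 p.2) : \bar R).
  exact: measurable_chi.
transitivity (\int[n]_x \int[mu]_u chi (b x u)).
  by apply: eq_integral => x _; rewrite integral_below.
rewrite tonelli//=; last by move=> *; exact: chi_ge0.
transitivity (\int[mu]_u \int[mu]_x (chi (b x u) * g x)).
  apply: eq_integral => u _.
  have mbu : measurable_fun setT (b ^~ u) by exact: (measurable_fun_pair1 u mb).
  rewrite integral_chi//.
  transitivity (n [set x | b x u]) => //; rewrite nE;
    last exact: measurable_boolset.
  rewrite integral_mkcond; apply: eq_integral => x _.
  rewrite patchE chiE (_ : (x \in _) = b x u); last by apply/idP/idP; rewrite inE.
  by case: (b x u); rewrite ?mul1e ?mul0e.
transitivity (\int[mu]_x \int[mu]_u (chi (b x u) * g x)).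
  rewrite [RHS]tonelli//=; last by move=> *; rewrite mule_ge0// chi_ge0.
  by apply: emeasurable_funM => //; exact: measurableT_comp.
apply: eq_integral => x _.
rewrite ge0_integralZr//; first by rewrite integral_below.
- exact: (measurable_fun_pair2 x mchi).
- by move=> *; exact: chi_ge0.
Qed.

End change_of_variables.

(** * Exponential gaps and the Poisson intensity *)

Section exponential_renewal.
Context {R : realType}.
Notation mu := (@lebesgue_measure R).
Variables (lam : R) (nu : probability R R).
Hypothesis lam_gt0 : (0 < lam)%R.
Hypothesis nuE : forall B : set R, measurable B -> nu B = exponential_prob lam B.

(** The expected sum of [f] over the points beyond [x] of a Poisson process of
    rate [lam].  The closed bound [x <= v] makes [exponential_cdf_pdf], and with
    it [poisson_intensity_step], exact at every point. *)
Definition poisson_intensity (f : R -> \bar R) (x : R) : \bar R :=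
  \int[mu]_v (lam%:E * (chi (x <= v)%R * f v)).

(** The density is [lam] times the tail probability; the additive form avoids
    subtracting extended reals. *)
Lemma exponential_cdf_pdf (y : R) :
  lam%:E * nu [set a | (a <= y)%R] + (exponential_pdf lam y)%:E =
  lam%:E * chi (0 <= y)%R.
Proof.
have -> : nu [set a | (a <= y)%R] = \int[mu]_(x in `[0%R, y])
  (exponential_pdf lam x)%:E.
  rewrite nuE /exponential_prob; last first.
    by apply: measurable_boolset; exact: measurable_fun_ler.
  rewrite integral_mkcond [RHS]integral_mkcond; apply: eq_integral => x _.
  rewrite !patchE; case: (leP 0%R x) => x0; last first.
    by rewrite lt0_exponential_pdf// !if_same.
  congr (if _ then _ else _); apply/idP/idP; rewrite !inE/= in_itv/= x0//.
case: (ltgtP y 0%R) => [y0|y0|->].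
- rewrite set_itv_ge ?bnd_simp -?ltNge// integral_set0 mule0 add0e.
  by rewrite lt0_exponential_pdf// chiE mule0.
- have := exponential_prob_itv0c lam y0; rewrite /exponential_prob => ->.
  rewrite exponential_pdfE ?ltW// chiE mule1 -EFinB -EFinM -EFinD.
  by congr EFin; ring.
- rewrite set_itv1 integral_set1 mule0 add0e exponential_pdfE//.
  by rewrite mulr0 expR0 mulr1 chiE mule1.
Qed.

Lemma integral_exponential (f : R -> \bar R) :
  measurable_fun setT f -> (forall x, 0 <= f x) ->
  \int[nu]_a f a = \int[mu]_a (f a * (exponential_pdf lam a)%:E).
Proof.
move=> mf f0; apply: ge0_integral_density => //.
- by apply/measurable_EFinP; exact: measurable_exponential_pdf.
- by move=> x; rewrite lee_fin exponential_pdf_ge0// ltW.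
Qed.

(** First-step analysis of the Poisson process.  The first point after [x] is
    [x + a]; it contributes [f (x + a)], and the points after it contribute the
    intensity from [x + a].  On the analytic side, a point [v >= x] receives the
    weight [pdf (v - x)] from the first integral and, after Tonelli, the weight
    [lam * nu (a <= v - x)] from the second, which sum up to [lam]. *)
Lemma poisson_intensity_step (f : R -> \bar R) (x : R) :
  measurable_fun setT f -> (forall x, 0 <= f x) ->
  \int[nu]_a f (x + a)%R + \int[nu]_a poisson_intensity f (x + a)%R =
  poisson_intensity f x.
Proof.
move=> mf f0.
have lam0 : 0 <= lam%:E by rewrite lee_fin ltW.
have mpdf : measurable_fun setT (fun v => (exponential_pdf lam v)%:E).
  by apply/measurable_EFinP; exact: measurable_exponential_pdf.
have pdf0 v : 0 <= (exponential_pdf lam v)%:E.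
  by rewrite lee_fin exponential_pdf_ge0// ltW.
have mshift : measurable_fun setT (fun v : R => v - x)%R by exact: measurable_funB.
have mfp : measurable_fun setT (fun v => f v * (exponential_pdf lam (v - x))%:E).
  by apply: emeasurable_funM => //; exact: (measurableT_comp mpdf).
rewrite integral_exponential//; last first.
  by apply: (measurableT_comp mf); exact: measurable_funD.
have -> : \int[mu]_a (f (x + a)%R * (exponential_pdf lam a)%:E) =
    \int[mu]_v (f v * (exponential_pdf lam (v - x))%:E).
  have fp0 v : 0 <= f v * (exponential_pdf lam (v - x))%:E by rewrite mule_ge0.
  rewrite -[RHS](@ge0_integral_shift R x (fun v =>
    f v * (exponential_pdf lam (v - x))%:E) mfp fp0).
  by apply: eq_integral => v _; rewrite [(x + v)%R]addrC addrK.
have -> : \int[nu]_a poisson_intensity f (x + a)%R =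
    \int[mu]_v (f v * (lam%:E * nu [set a | (a <= v - x)%R])).
  rewrite /poisson_intensity tonelli//=; last 2 first.
  - apply: emeasurable_funM => //; apply: emeasurable_funM; last first.
      exact: (measurableT_comp mf).
    apply: measurable_chi_le => //.
    by apply: measurable_funD.
  - by move=> *; rewrite !mule_ge0// chi_ge0.
  apply: eq_integral => v _.
  transitivity (\int[nu]_a (f v * (lam%:E * chi (a <= v - x)%R))).
    by apply: eq_integral => a _; rewrite muleA muleC lerBrDl.
  have mchi : measurable_fun setT (fun a : R => chi (a <= v - x)%R : \bar R).
    exact: measurable_chi_le.
  rewrite ge0_integralZl//; last 2 first.
  - exact: emeasurable_funM.
  - by move=> *; rewrite mule_ge0// chi_ge0.
  rewrite ge0_integralZl//; last by move=> *; exact: chi_ge0.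
  by rewrite integral_chi//; exact: measurable_fun_ler.
rewrite -ge0_integralD//; last 3 first.
- by move=> v _; rewrite mule_ge0.
- by move=> v _; rewrite !mule_ge0.
- apply: emeasurable_funM => //; apply: emeasurable_funM => //.
  have -> : (fun v : R => nu [set a | (a <= v - x)%R]) =
      fun v : R => \int[nu]_a chi (a <= v - x)%R.
    by apply/funext => v; rewrite integral_chi//; exact: measurable_fun_ler.
  apply: measurable_ge0_integral => [|*]; last exact: chi_ge0.
  by apply: measurable_chi_le => //; exact: (measurableT_comp mshift).
apply: eq_integral => v _; rewrite -ge0_muleDr ?mule_ge0// addeC.
by rewrite exponential_cdf_pdf subr_ge0 muleC -muleA.
Qed.
End exponential_renewal.

(** * Independence of a variable from the rest of a family *)

Section independence.
Context d (Omega : measurableType d) (R : realType) (P : probability Omega R).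
Context (I : eqType) (Z : I -> {RV P >-> R}).

Definition cylinder (J : seq I) (B : I -> set R) : set Omega :=
  \bigcap_(i in [set` J]) (Z i @^-1` B i).

(** This says of [X] what matters about a function of the variables indexed by
    [U]: it is independent of all the others.  Since [T] is arbitrary, [X] can
    collect the variables in use one at a time, and joint laws of any finite
    number of variables are only ever handled as products of two measures. *)
Definition independent_outside (U : pred I) d' (T : measurableType d')
    (X : Omega -> T) : Prop :=
  measurable_fun setT X /\
  forall A J B, measurable A -> uniq J -> {in J, forall i, ~~ U i} ->
    (forall i, measurable (B i)) ->
    P (X @^-1` A `&` cylinder J B) = P (X @^-1` A) * P (cylinder J B).

Lemma cylinder_nil B : cylinder [::] B = setT.
Proof. by rewrite /cylinder set_nil bigcap_set0. Qed.

Lemma cylinder_cons i J B :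
  cylinder (i :: J) B = Z i @^-1` B i `&` cylinder J B.
Proof.
apply/seteqP; split=> [w H|w [Hi H] j /=].
  split; first by apply: H; rewrite /= mem_head.
  by move=> j jJ; apply: H; rewrite /= in_cons (_ : j \in J) ?orbT.
by rewrite in_cons => /orP[/eqP->//|]; exact: H.
Qed.

Lemma measurable_cylinder J B : (forall i, measurable (B i)) ->
  measurable (cylinder J B).
Proof.
move=> mB; elim: J => [|i J IH]; first by rewrite cylinder_nil.
rewrite cylinder_cons; apply: measurableI => //.
by rewrite -[X in measurable X]setTI; exact: measurable_funP.
Qed.

Lemma independent_outside_cst d' (T : measurableType d') (c : T) :
  independent_outside pred0 (fun=> c).
Proof.
split=> // A J B mA _ _ mB; rewrite (preimage_cst c A).
by case: ifP; rewrite ?setTI ?set0I ?probability_setT ?mul1e ?measure0 ?mul0e.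
Qed.

Lemma independent_outside_comp (U V : pred I) d' (T : measurableType d')
    (X : Omega -> T) d2 (T2 : measurableType d2) (phi : T -> T2)
    (Y : Omega -> T2) :
  (forall w, Y w = phi (X w)) -> measurable_fun setT phi -> subpred U V ->
  independent_outside U X -> independent_outside V Y.
Proof.
move=> /funext YE mphi UV [mX XP].
have {YE} -> : Y = phi \o X by [].
split=> [|A J B mA uJ JV mB]; first exact: measurableT_comp.
rewrite comp_preimage; apply: XP => //.
  by rewrite -[X in measurable X]setTI; exact: mphi.
by move=> i /JV; apply: contra; exact: UV.
Qed.

Hypothesis Zindep : mutually_independent Z.

Lemma independent_cylinder i J B : uniq (i :: J) ->
  (forall i, measurable (B i)) ->
  P (cylinder (i :: J) B) = P (Z i @^-1` B i) * P (cylinder J B).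
Proof.
move=> uJ mB; have /andP[_ uJ'] := uJ.
have mZ k : measurable (Z k @^-1` B k).
  by rewrite -[X in measurable X]setTI; exact: measurable_funP.
have fC K : P (cylinder K B) \is a fin_num.
  by rewrite fin_num_measure//; exact: measurable_cylinder.
rewrite -[LHS]fineK// -[X in _ * X]fineK// -[X in X * _]fineK ?fin_num_measure//.
by rewrite /cylinder !Zindep// big_cons EFinM.
Qed.

Lemma independent_outside_pair (U : pred I) i d' (T : measurableType d')
    (X : Omega -> T) :
  ~~ U i -> independent_outside U X ->
  forall A B, measurable A -> measurable B ->
  P (X @^-1` A `&` Z i @^-1` B) = P (X @^-1` A) * P (Z i @^-1` B).
Proof.
move=> Ui [mX XP] A B mA mB.
have := XP A [:: i] (fun=> B) mA isT; rewrite cylinder_cons.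
rewrite cylinder_nil setIT; apply => //.
by move=> j; rewrite inE => /eqP ->.
Qed.

(** For a fixed cylinder, both sides are finite measures of the set [C] of
    values of the pair, and they agree on rectangles; hence they agree. *)
Lemma independent_outside_cons (U : pred I) i d' (T : measurableType d')
    (X : Omega -> T) :
  ~~ U i -> independent_outside U X ->
  independent_outside (predU1 i U) (fun w => (X w, Z i w)).
Proof.
move=> Ui XU; have [mX XP] := XU.
have mXZ : measurable_fun setT (fun w => (X w, Z i w)).
  exact: measurable_fun_pair.
split=> // C J B mC uJ JU mB.
have mE := measurable_cylinder J mB.
have iJ : i \notin J by apply: contraTN isT => /JU; rewrite /= eqxx.
have JU' : {in J, forall j, ~~ U j} by move=> j /JU; rewrite /= negb_or => /andP[].
have fE : P (cylinder J B) \is a fin_num by rewrite fin_num_measure.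
pose X' : {mfun Omega >-> T} := HB.pack X (isMeasurableFun.Build _ _ _ _ _ mX).
pose XZ : {mfun Omega >-> (T * R)%type} :=
  HB.pack (fun w => (X w, Z i w)) (isMeasurableFun.Build _ _ _ _ _ mXZ).
pose p : {nonneg R} := NngNum (fine_ge0 (measure_ge0 P (cylinder J B))).
have pE : p%:num%:E = P (cylinder J B) by rewrite /= fineK.
have H1 := @product_measure_unique _ _ _ _ R
  (mscale p (distribution P X')) (distribution P (Z i))
  (pushforward (mrestr P mE) XZ) _ C mC.
have H2 := @product_measure_unique _ _ _ _ R
  (mscale p (distribution P X')) (distribution P (Z i))
  (mscale p (distribution P XZ)) _ C mC.
transitivity (pushforward (mrestr P mE) XZ C) => //.
rewrite -H1; last first.
  move=> A D mA mD.
  change (P ((X @^-1` A `&` Z i @^-1` D) `&` cylinder J B) =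
    p%:num%:E * P (X @^-1` A) * P (Z i @^-1` D)).
  rewrite -setIA.
  pose B' j := if j == i then D else B j.
  have EB : cylinder J B = cylinder J B'.
    apply: eq_bigcapr => j /= jJ; rewrite /B'; case: eqP => // ji.
    by rewrite -ji jJ in iJ.
  have mB' j : measurable (B' j) by rewrite /B'; case: ifP.
  have uiJ : uniq (i :: J) by rewrite /= iJ.
  have -> : Z i @^-1` D `&` cylinder J B = cylinder (i :: J) B'.
    by rewrite cylinder_cons -EB /B' eqxx.
  rewrite XP//; last by move=> j; rewrite inE => /orP[/eqP->//|/JU'].
  by rewrite independent_cylinder// -EB /B' eqxx pE muleA muleC muleA.
rewrite H2; last first.
  move=> A D mA mD.
  change (p%:num%:E * P (X @^-1` A `&` Z i @^-1` D) =
    p%:num%:E * P (X @^-1` A) * P (Z i @^-1` D)).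
  by rewrite (independent_outside_pair Ui XU)// muleA.
by rewrite -pE muleC.
Qed.

(** A fresh variable may be integrated out first, everything else frozen. *)
Lemma integral_independent_pair (U : pred I) i d' (T : measurableType d')
    (X : Omega -> T) (mu : probability R R) (f : T -> R -> \bar R) :
  ~~ U i -> independent_outside U X ->
  (forall B, measurable B -> distribution P (Z i) B = mu B) ->
  measurable_fun setT (fun p : T * R => f p.1 p.2) ->
  (forall x z, 0 <= f x z) ->
  \int[P]_w f (X w) (Z i w) = \int[P]_w \int[mu]_z f (X w) z.
Proof.
move=> Ui XU ZE mf f0; have [mX _] := XU.
have mXZ : measurable_fun setT (fun w => (X w, Z i w)).
  exact: measurable_fun_pair.
pose X' : {mfun Omega >-> T} := HB.pack X (isMeasurableFun.Build _ _ _ _ _ mX).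
pose XZ : {mfun Omega >-> (T * R)%type} :=
  HB.pack (fun w => (X w, Z i w)) (isMeasurableFun.Build _ _ _ _ _ mXZ).
have XZE := @product_measure_unique _ _ _ _ R
  (distribution P X') mu (distribution P XZ).
transitivity (\int[distribution P XZ]_p f p.1 p.2).
  by rewrite ge0_integral_distribution.
transitivity (\int[distribution P X' \x mu]_p f p.1 p.2).
  apply: eq_measure_integral => C mC _; apply/esym/XZE => // A B mA mB.
  transitivity (distribution P X' A * distribution P (Z i) B).
    exact: (independent_outside_pair Ui XU).
  by congr (_ * _); exact: ZE.
rewrite (fubini_tonelli1 (fun p => f p.1 p.2))//.
rewrite ge0_integral_distribution//.
- exact: measurable_ge0_integral.
- by move=> x; exact: integral_ge0.
Qed.

End independence.

(** * Moments of the infinite-server queue *)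

Section poisson_arrivals.
Context d (Omega : measurableType d) (R : realType) (P : probability Omega R).
Context (a s : nat -> {RV P >-> R}) (lam : R) (nu sig : probability R R).
Hypothesis lam_gt0 : (0 < lam)%R.
Hypothesis nuE : forall B : set R, measurable B -> nu B = exponential_prob lam B.
Hypothesis aE : forall k (B : set R), measurable B -> distribution P (a k) B = nu B.
Hypothesis sE : forall k (B : set R), measurable B -> distribution P (s k)
  B = sig B.
Hypothesis indep : independent_sequences a s.

Notation mu := (@lebesgue_measure R).
Local Notation PI := (poisson_intensity lam).

Let Z (i : nat + nat) : {RV P >-> R} :=
  match i with inl k => a k | inr k => s k end.
Let Zindep : mutually_independent Z := indep.

Definition partial_sum (j m : nat) (w : Omega) : R := \sum_(i < m) a (j + i) w.

Lemma measurable_partial_sum j m : measurable_fun setT (partial_sum j m).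
Proof. by apply: measurable_sum => i; exact: measurable_funP. Qed.

Lemma measurable_poisson_intensity d' (T : measurableType d')
    (h : T -> R -> \bar R) :
  measurable_fun setT (fun p : T * R => h p.1 p.2) ->
  (forall y v, 0 <= h y v) ->
  measurable_fun setT (fun p : T * R => PI (h p.1) p.2).
Proof.
move=> mh h0; have lam0 : 0 <= lam%:E by rewrite lee_fin ltW.
apply: (@measurable_ge0_integral _ _ _ _ R mu
  (fun (p : T * R) v => lam%:E * (chi (p.2 <= v)%R * h p.1 v))).
  apply: emeasurable_funM => //; apply: emeasurable_funM.
    apply: measurable_chi_le => //.
    exact: measurableT_comp.
  have mg : measurable_fun setT (fun q : (T * R) * measurableTypeR R =>
    (q.1.1, q.2 : R)).
    apply: measurable_fun_pair => //.
    exact: measurableT_comp.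
  exact: (measurableT_comp mh mg).
by move=> *; rewrite !mule_ge0// chi_ge0.
Qed.

Lemma poisson_intensity_ge0 (f : R -> \bar R) x :
  (forall v, 0 <= f v) -> 0 <= PI f x.
Proof.
move=> f0; apply: integral_ge0 => v _.
by rewrite !mule_ge0// ?chi_ge0// lee_fin ltW.
Qed.

Definition used_variables (U : pred (nat + nat)) (j m : nat) : pred (nat + nat) :=
  fun i => U i || (if i is inl k then (j <= k < j + m)%N else false).

Section renewal.
Variables (U : pred (nat + nat)) (d' : measure_display) (T : measurableType d').
Variables (Y : Omega -> T) (x : Omega -> R) (j : nat).
Variable h : T -> R -> \bar R.
Hypothesis YxU : independent_outside Z U (fun w => (Y w, x w)).
Hypothesis Uj : forall i, (j <= i)%N -> ~~ U (inl i).
Hypothesis mh : measurable_fun setT (fun p : T * R => h p.1 p.2).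
Hypothesis h0 : forall y v, 0 <= h y v.

Let X m w := (Y w, (x w + partial_sum j m w)%R).

Lemma independent_outside_partial_sum m :
  independent_outside Z (used_variables U j m)
    (fun w => (Y w, (x w + partial_sum j m w)%R)).
Proof.
rewrite -/(X m).
elim: m => [|m IH].
  apply: (independent_outside_comp (phi := id)) YxU => //; last by move=> i Ui;
    rewrite /used_variables Ui.
  by move=> w; rewrite /X /partial_sum big_ord0 addr0.
have Vjm : ~~ used_variables U j m (inl (j + m)%N).
  by rewrite /used_variables /= ltnn andbF orbF Uj// leq_addr.
pose phi (p : (T * R) * R) : T * R := (p.1.1, (p.1.2 + p.2)%R).
apply: (independent_outside_comp (phi := phi) _ _ _
  (independent_outside_cons Zindep Vjm IH)).
- by move=> w; rewrite /X /partial_sum big_ord_recr/= addrA.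
- apply: measurable_fun_pair; first exact: measurableT_comp.
  by apply: measurable_funD => //; exact: measurableT_comp.
- move=> i; rewrite /= /used_variables => /orP[/eqP->|/orP[->//|]].
    by rewrite /= leq_addr addnS ltnS leqnn orbT.
  by case: i => // k /andP[jk kj]; rewrite jk addnS ltnS (ltnW kj) orbT.
Qed.

(** [m] iterations of [poisson_intensity_step], for a Poisson process started
    at the random point [x] and a function that depends on the past [Y]. *)
Lemma renewal_split m :
  \int[P]_w PI (h (Y w)) (x w) =
  \sum_(l < m) \int[P]_w h (Y w) (x w + partial_sum j l.+1 w)%R +
  \int[P]_w PI (h (Y w)) (x w + partial_sum j m w)%R.
Proof.
elim: m => [|m IH].
  rewrite big_ord0 add0e; apply: eq_integral => w _.
  by rewrite /partial_sum big_ord0 addr0.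
rewrite IH big_ord_recr/= -addeA; congr (_ + _).
have Vjm : ~~ used_variables U j m (inl (j + m)%N).
  by rewrite /used_variables /= ltnn andbF orbF Uj// leq_addr.
have madd : measurable_fun setT (fun p : (T * R) * R => (p.1.1, (p.1.2 + p.2)%R)).
  apply: measurable_fun_pair; first exact: measurableT_comp.
  by apply: measurable_funD => //; exact: measurableT_comp.
have mPI := measurable_poisson_intensity mh h0.
have mX : measurable_fun setT (X m) by have [] := independent_outside_partial_sum m.
have PI0 y v : 0 <= PI (h y) v by exact: poisson_intensity_ge0.
have := integral_independent_pair (f := fun (p : T * R) z =>
  h p.1 (p.2 + z)%R) Vjm (independent_outside_partial_sum m) (aE (j + m)).
move=> /(_ (measurableT_comp mh madd) (fun _ _ => h0 _ _)) /= E1.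
have := integral_independent_pair (f := fun (p : T * R) z =>
  PI (h p.1) (p.2 + z)%R) Vjm (independent_outside_partial_sum m) (aE (j + m)).
move=> /(_ (measurableT_comp mPI madd) (fun _ _ => PI0 _ _)) /= E2.
have psE w : (x w + partial_sum j m.+1 w = x w + partial_sum j m w + a (j + m) w)%R.
  by rewrite /partial_sum big_ord_recr/= addrA.
under [X in _ = X + _]eq_integral do rewrite psE.
under [X in _ = _ + X]eq_integral do rewrite psE.
rewrite {}E1 {}E2 -ge0_integralD//; last 4 first.
- by move=> w _; exact: integral_ge0.
- apply: (measurableT_comp (f := fun p : T * R =>
    \int[nu]_z h p.1 (p.2 + z)%R) _ mX).
  apply: (@measurable_ge0_integral _ _ _ _ R nu (fun (p : T * R) z =>
    h p.1 (p.2 + z)%R)) => //.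
  exact: (measurableT_comp mh madd).
- by move=> w _; exact: integral_ge0.
- apply: (measurableT_comp (f := fun p : T * R =>
    \int[nu]_z PI (h p.1) (p.2 + z)%R) _ mX).
  apply: (@measurable_ge0_integral _ _ _ _ R nu (fun (p : T * R) z =>
    PI (h p.1) (p.2 + z)%R)) => //.
  exact: (measurableT_comp mPI madd).
apply: eq_integral => w _ /=.
rewrite poisson_intensity_step//.
exact: (measurable_fun_pair2 (Y w) mh).
Qed.

Lemma renewal_le :
  \sum_(0 <= l <oo) \int[P]_w h (Y w) (x w + partial_sum j l.+1 w)%R <=
  \int[P]_w PI (h (Y w)) (x w).
Proof.
apply: lime_le.
  by apply: is_cvg_nneseries => *; exact: integral_ge0.
near=> m; rewrite (renewal_split m) big_mkord leeDl//.
by apply: integral_ge0 => *; exact: poisson_intensity_ge0.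
Unshelve. all: by end_near. Qed.

End renewal.

Definition arrival (k : nat) (w : Omega) : R := partial_sum 0 k.+1 w.

Lemma measurable_arrival k : measurable_fun setT (arrival k).
Proof. exact: measurable_partial_sum. Qed.

Lemma arrivalD i l w :
  arrival (i.+1 + l) w = (arrival i w + partial_sum i.+1 l.+1 w)%R.
Proof.
rewrite /arrival /partial_sum -addnS big_split_ord/=.
by congr (_ + _)%R; apply: eq_bigr => m _; rewrite add0n.
Qed.

Lemma independent_outside_arrival k :
  independent_outside Z (used_variables pred0 0 k.+1) (arrival k).
Proof.
have := @independent_outside_partial_sum pred0 _ unit (fun=> tt) (fun=> 0%R) 0%N
  (@independent_outside_cst _ _ R P _ Z _ (unit * R)%type (tt, 0%R))
    (fun _ _ => isT) k.+1.
by apply: independent_outside_comp measurable_snd _ => // w; rewrite /= add0r.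
Qed.

Lemma arrival_renewal (f : R -> \bar R) m :
  measurable_fun setT f -> (forall v, 0 <= f v) ->
  PI f 0%R =
  \sum_(k < m) \int[P]_w f (arrival k w) + \int[P]_w PI f (partial_sum 0 m w).
Proof.
move=> mf f0.
have := @renewal_split pred0 _ unit (fun=> tt) (fun=> 0%R) 0%N (fun=> f)
  (@independent_outside_cst _ _ R P _ Z _ (unit * R)%type (tt, 0%R))
    (fun _ _ => isT)
  (measurableT_comp mf measurable_snd) (fun _ => f0) m.
move=> H; transitivity (\int[P]_w PI f 0%R); last rewrite [LHS]H.
  by rewrite integral_probability_cst.
apply: f_equal2; last by apply: eq_integral => w _; rewrite add0r.
by apply: eq_bigr => k _; apply: eq_integral => w _; rewrite add0r.
Qed.

Lemma arrival_intensity_le (f : R -> \bar R) :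
  measurable_fun setT f -> (forall v, 0 <= f v) ->
  \sum_(0 <= k <oo) \int[P]_w f (arrival k w) <= PI f 0%R.
Proof.
move=> mf f0; apply: lime_le.
  by apply: is_cvg_nneseries => *; exact: integral_ge0.
near=> m; rewrite (@arrival_renewal f m)// big_mkord leeDl//.
by apply: integral_ge0 => *; exact: poisson_intensity_ge0.
Unshelve. all: by end_near. Qed.

Lemma integral_chi_itv (t : R) : (0 <= t)%R ->
  \int[mu]_v chi ((0 <= v)%R && (v <= t)%R) = t%:E.
Proof.
move=> t0; rewrite integral_chi; last first.
  by apply: measurable_and; exact: measurable_fun_ler.
rewrite (_ : [set _ | _] = `[0%R, t]%classic); last first.
  by apply/seteqP; split=> x /=; rewrite in_itv/=.
rewrite /= lebesgue_measure_itv/= lte_fin.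
by case: ltgtP t0 => // [_ _|<- _]; rewrite ?oppr0 ?adde0.
Qed.

Lemma poisson_intensity_window (t : R) : (0 <= t)%R ->
  PI (fun v => chi (v <= t)%R) 0%R = (lam * t)%:E.
Proof.
move=> t0; rewrite /poisson_intensity.
under eq_integral do rewrite -chi_and.
rewrite ge0_integralZl_EFin//; last 3 first.
- by move=> *; exact: chi_ge0.
- by apply: measurable_chi; apply: measurable_and; exact: measurable_fun_ler.
- exact: ltW.
by rewrite integral_chi_itv// EFinM.
Qed.

Lemma integral_arrival_le k t :
  \int[P]_w chi (arrival k w <= t)%R = P [set w | (arrival k w <= t)%R].
Proof.
by rewrite integral_chi//; apply: measurable_fun_ler => //;
  exact: measurable_arrival.
Qed.

Lemma expected_arrivals_le (t : R) : (0 <= t)%R ->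
  \sum_(0 <= k <oo) P [set w | (arrival k w <= t)%R] <= (lam * t)%:E.
Proof.
move=> t0; rewrite -poisson_intensity_window//.
under eq_eseriesr do rewrite -integral_arrival_le.
by apply: arrival_intensity_le => [|*]; [exact: measurable_chi_le|exact: chi_ge0].
Qed.

Lemma prob_arrival_le_small (t eps : R) : (0 <= t)%R -> (0 < eps)%R ->
  exists k, P [set w | (arrival k w <= t)%R] <= eps%:E.
Proof.
move=> t0 eps0.
have := @nneseries_tail_cvg R (fun k => P [set w | (arrival k w <= t)%R]) xpredT.
move=> /(_ (le_lt_trans (expected_arrivals_le t0) (ltry _))) /(_ (fun _ _ =>
  measure_ge0 _ _)).
have lt_eps : nbhs (0 : \bar R) [set x | x < eps%:E].
  by apply: open_nbhs_nbhs; split; [exact: open_ereal_lt_ereal|rewrite /= lte_fin].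
move=> /(_ _ lt_eps) [N _ /(_ N (leqnn N)) /= tailN]; exists N.
apply: le_trans (ltW tailN).
apply: le_trans (nneseries_lim_ge N.+1 _); last by move=> *; exact: measure_ge0.
by rewrite big_nat1.
Qed.

Lemma interarrival_ge0 : {ae P, forall w k, (0 <= a k w)%R}.
Proof.
apply/ae_foralln => k; exists [set w | (a k w < 0)%R]; split.
- by apply: measurable_boolset; exact: measurable_fun_ltr.
- have m0 : measurable [set x : R | (x < 0)%R].
    by apply: measurable_boolset; exact: measurable_fun_ltr.
  transitivity (distribution P (a k) [set x | (x < 0)%R]) => //.
  rewrite aE// nuE// /exponential_prob; apply: integral0_eq => x /= x0.
  by rewrite lt0_exponential_pdf.
- by move=> w /= /negP; rewrite -ltNge.
Qed.

Lemma arrival_ge0 k w : (forall i, (0 <= a i w)%R) -> (0 <= arrival k w)%R.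
Proof. by move=> a0; apply: sumr_ge0 => i _. Qed.

Lemma arrivals_unbounded (t : R) : (0 <= t)%R ->
  {ae P, forall w, exists k, (t < arrival k w)%R}.
Proof.
move=> t0; pose A := \bigcap_k [set w | (arrival k w <= t)%R].
have mA k : measurable [set w | (arrival k w <= t)%R].
  apply: measurable_boolset; apply: measurable_fun_ler => //.
  exact: measurable_arrival.
exists A; split.
- exact: bigcapT_measurable.
- apply/eqP; rewrite eq_le measure_ge0 andbT; apply/lee_addgt0Pr => e e0.
  have [k Pk] := prob_arrival_le_small t0 e0.
  rewrite add0e; apply: le_trans Pk; apply: le_measure; rewrite ?inE//.
    exact: bigcapT_measurable.
  by move=> w; apply.
- by move=> w /= /forallNP H k _; rewrite /= leNgt; apply/negP.
Qed.

(** The remainder of [arrival_renewal] after [k] steps is at most [lam * t]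
    times the probability that the [k]-th arrival is before [t], because from
    [x >= 0] there is at most [lam * t] to collect, and nothing if [t < x].
    These probabilities have a finite sum, so they are arbitrarily small. *)
Lemma arrival_intensity_eq (f : R -> \bar R) (t : R) : (0 <= t)%R ->
  measurable_fun setT f -> (forall v, 0 <= f v <= chi (v <= t)%R) ->
  \sum_(0 <= k <oo) \int[P]_w f (arrival k w) = PI f 0%R.
Proof.
move=> t0 mf f01.
have f0 v : 0 <= f v by case/andP: (f01 v).
apply/eqP; rewrite eq_le arrival_intensity_le//=.
have lt0 : (0 <= lam * t)%R by rewrite mulr_ge0// ltW.
have PIf x : (0 <= x)%R -> PI f x <= (lam * t)%:E * chi (x <= t)%R.
  move=> x0; rewrite chiE; case: ifP => [xt|/negbT xt].
    rewrite mule1 -poisson_intensity_window//; apply: ge0_le_integral => //.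
    - by move=> v _; rewrite !mule_ge0 ?chi_ge0// lee_fin ltW.
    - by apply: emeasurable_funM => //; apply: emeasurable_funM => //;
        exact: measurable_chi_le.
    - by apply: emeasurable_funM => //; apply: emeasurable_funM => //;
        exact: measurable_chi_le.
    - move=> v _; rewrite lee_pmul2l ?lte_fin// -?fin_numE//.
      apply: lee_pmul; rewrite ?chi_ge0//; last by case/andP: (f01 v).
      by apply: le_chi; exact: le_trans.
  rewrite mule0 /poisson_intensity integral0_eq// => v _.
  case: (leP x v) => xv; last by rewrite chiE mul0e mule0.
  have /andP[_] := f01 v; rewrite [X in _ <= X]chiE ifF; last first.
    by apply/negbTE; rewrite -ltNge (lt_le_trans _ xv)// ltNge.
  by move=> fv; rewrite (@le_anti _ _ (f v) 0) ?mule0// fv f0.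
apply/lee_addgt0Pr => e e0.
(* so that [lam * t] times the probability is at most [e]; the [+ 1] covers
   [t = 0] *)
have [k Pk] := @prob_arrival_le_small t (e / (lam * t + 1))
  t0 (divr_gt0 e0 (ltr_wpDl lt0 ltr01)).
rewrite (@arrival_renewal f k.+1)//; apply: leeD.
  by rewrite -(big_mkord xpredT (fun k => \int[P]_w f (arrival k w)))
    nneseries_lim_ge// => *; exact: integral_ge0.
apply: (@le_trans _ _ (\int[P]_w ((lam * t)%:E * chi (arrival k w <= t)%R))).
  apply: ae_ge0_le_integral => //.
  - by move=> *; exact: poisson_intensity_ge0.
  - have := measurable_poisson_intensity (h := fun _ : unit =>
      f) (measurableT_comp mf measurable_snd) (fun _ => f0).
    move=> /(measurable_fun_pair2 tt) H; exact: (measurableT_comp H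
      (measurable_partial_sum _ _)).
  - by move=> *; rewrite mule_ge0 ?chi_ge0.
  - by apply: emeasurable_funM => //; apply: measurable_chi_le => //;
      exact: measurable_arrival.
  - by apply: filterS interarrival_ge0 => w a0 _; exact/PIf/arrival_ge0.
rewrite ge0_integralZl_EFin//; last 2 first.
- by move=> *; exact: chi_ge0.
- by apply: measurable_chi_le => //; exact: measurable_arrival.
rewrite integral_arrival_le.
apply: le_trans (lee_wpmul2l _ Pk) _; first by rewrite lee_fin.
rewrite -EFinM lee_fin mulrA ler_pdivrMr ?ltr_wpDl// mulrC mulrDr mulr1 lerDl ltW//.
Qed.

(** The probability that a job arrived at time [v], and served at once, is
    present at time [t]. *)
Definition remaining_prob (t v : R) : \bar R :=
  \int[sig]_z chi ((v <= t)%R && (t < v + z)%R).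

(** Presence of job [k] at time [t] in the queue with infinitely many servers
    fed by the same arrivals and service times. *)
Definition unfinished (t : R) (k : nat) (w : Omega) : bool :=
  (arrival k w <= t)%R && (t < arrival k w + s k w)%R.

Lemma measurable_window d' (T : measurableType d') (t : R) (f g : T -> R) :
  measurable_fun setT f -> measurable_fun setT g ->
  measurable_fun setT (fun p => (f p <= t)%R && (t < f p + g p)%R).
Proof.
move=> mf mg; apply: measurable_and; first exact: measurable_fun_ler.
by apply: measurable_fun_ltr => //; exact: measurable_funD.
Qed.

Lemma measurable_remaining_prob t : measurable_fun setT (remaining_prob t).
Proof.
apply: measurable_ge0_integral => [|*]; last exact: chi_ge0.
by apply: measurable_chi; exact: measurable_window.
Qed.

Lemma remaining_prob_ge0 t v : 0 <= remaining_prob t v.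
Proof. by apply: integral_ge0 => *; exact: chi_ge0. Qed.

Lemma remaining_prob_le t v : remaining_prob t v <= chi (v <= t)%R.
Proof.
apply: (@le_trans _ _ (\int[sig]_z chi (v <= t)%R)).
  apply: ge0_le_integral => //.
  - by move=> *; exact: chi_ge0.
  - by apply: measurable_chi; apply: measurable_window.
  - by move=> z _; apply: le_chi => /andP[].
by rewrite integral_probability_cst.
Qed.

Lemma measurable_unfinished t k : measurable_fun setT (unfinished t k).
Proof. by apply: measurable_window => //; exact: measurable_arrival. Qed.

Lemma unfinished_prob t k :
  \int[P]_w chi (unfinished t k w) = \int[P]_w remaining_prob t (arrival k w).
Proof.
have Uk : ~~ used_variables pred0 0 k.+1 (inr k : nat + nat) by [].
have := integral_independent_pair (f := fun x z : R =>
  chi ((x <= t)%R && (t < x + z)%R))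
  Uk (independent_outside_arrival k) (sE k).
apply=> [|*]; last exact: chi_ge0.
by apply: measurable_chi; exact: measurable_window.
Qed.

Definition mean_unfinished (t : R) : \bar R := PI (remaining_prob t) 0%R.

Lemma sum_unfinished_prob t : (0 <= t)%R ->
  \sum_(0 <= k <oo) \int[P]_w chi (unfinished t k w) = mean_unfinished t.
Proof.
move=> t0; under eq_eseriesr do rewrite unfinished_prob.
apply: arrival_intensity_eq t0 _ _; first exact: measurable_remaining_prob.
by move=> v; rewrite remaining_prob_ge0 remaining_prob_le.
Qed.

Let PIr t := PI (remaining_prob t).

Let mPIr t : measurable_fun setT (PIr t).
Proof.
have := measurable_poisson_intensity (h := fun _ : unit => remaining_prob t)
  (measurableT_comp (measurable_remaining_prob t) measurable_snd)
  (fun _ => remaining_prob_ge0 t).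
by move/(measurable_fun_pair2 tt).
Qed.

Let PIr0 t x : 0 <= PIr t x.
Proof. by apply: poisson_intensity_ge0; exact: remaining_prob_ge0. Qed.

(** Given the past of job [i], the later arrivals form a Poisson process
    started at its arrival time: this is the renewal bound with
    [Y = (arrival i, s i)], followed by integrating out [s i]. *)
Lemma sum_unfinished_pair_le t i :
  \sum_(0 <= l <oo) \int[P]_w (chi (unfinished t i w)
    * chi (unfinished t (i.+1 + l) w))
  <= \int[P]_w (remaining_prob t (arrival i w) * PIr t (arrival i w)).
Proof.
pose U := predU1 (inr i : nat + nat) (used_variables pred0 0 i.+1).
have XU : independent_outside Z U (fun w => (arrival i w, s i w)).
  by apply: independent_outside_cons => //; exact: independent_outside_arrival.
have Ui k : (i.+1 <= k)%N -> ~~ U (inl k).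
  by rewrite /U /= /used_variables /= add0n -leqNgt.
have YxU : independent_outside Z U (fun w => ((arrival i w, s i w), arrival i w)).
  apply: (independent_outside_comp (phi := fun p : R * R => (p, p.1))) XU => //.
  exact: measurable_fun_pair.
pose b (y : R * R) := (y.1 <= t)%R && (t < y.1 + y.2)%R.
have mb : measurable_fun setT b by exact: measurable_window.
have mcb : measurable_fun setT (fun y => chi (b y) : \bar R)
  by exact: measurable_chi.
pose h (y : R * R) v := chi (b y) * remaining_prob t v.
have mh : measurable_fun setT (fun p : (R * R) * R => h p.1 p.2).
  apply: emeasurable_funM; first exact: (measurableT_comp mcb measurable_fst).
  exact: (measurableT_comp (measurable_remaining_prob t)).
have h0 y v : 0 <= h y v by rewrite mule_ge0 ?chi_ge0// remaining_prob_ge0.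
have PIh y v : PI (h y) v = chi (b y) * PIr t v.
  rewrite /h /PIr chiE; case: (b y); last first.
    by rewrite mul0e; apply: integral0_eq => u _; rewrite mul0e !mule0.
  by rewrite mul1e; congr PI; apply/funext => u; rewrite mul1e.
have E1 l : \int[P]_w (chi (unfinished t i w) * chi (unfinished t (i.+1 + l) w)) =
    \int[P]_w h (arrival i w, s i w) (arrival i w + partial_sum i.+1 l.+1 w)%R.
  have Vj : ~~ used_variables U i.+1 l.+1 (inr (i.+1 + l)%N).
    rewrite /used_variables orbF /U /= orbF; apply/eqP => -[] /eqP.
    by rewrite -[X in _ == X]addn0 addSnnS eqn_add2l.
  have := integral_independent_pair (f := fun (p : (R * R) * R) z =>
    chi (b p.1) * chi ((p.2 <= t)%R && (t < p.2 + z)%R)) Vj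
    (independent_outside_partial_sum YxU Ui l.+1) (sE (i.+1 + l)).
  move=> H; etransitivity; last (etransitivity; first apply: H).
  - by apply: eq_integral => w _; rewrite /unfinished arrivalD.
  - apply: emeasurable_funM.
      by apply: (measurableT_comp mcb (measurableT_comp measurable_fst
        measurable_fst)).
    apply: measurable_chi; apply: measurable_window => //.
    exact: measurableT_comp.
  - by move=> *; rewrite mule_ge0 ?chi_ge0.
  - apply: eq_integral => w _ /=; rewrite ge0_integralZl ?chi_ge0//.
    + by apply: measurable_chi; exact: measurable_window.
    + by move=> *; exact: chi_ge0.
under eq_eseriesr do rewrite E1.
apply: le_trans (renewal_le YxU Ui mh h0) _.
under eq_integral do rewrite PIh.
have Uk : ~~ used_variables pred0 0 i.+1 (inr i : nat + nat) by [].
rewrite (integral_independent_pair (f := fun x z : R =>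
  chi ((x <= t)%R && (t < x + z)%R) * PIr t x)
  Uk (independent_outside_arrival i) (sE i)).
- rewrite le_eqVlt; apply/orP; left; apply/eqP/eq_integral => w _;
    rewrite ge0_integralZr//.
  + by apply: measurable_chi; exact: measurable_window.
  + by move=> *; exact: chi_ge0.
- apply: emeasurable_funM; first by apply: measurable_chi; exact: measurable_window.
  exact: (measurableT_comp (mPIr t)).
- by move=> *; rewrite mule_ge0 ?chi_ge0.
Qed.

(** The left side integrates [g] twice over ordered pairs of points; by symmetry
    ordered pairs are half of all pairs, since the diagonal has measure zero. *)
Lemma poisson_intensity_square (g : R -> \bar R) :
  measurable_fun setT g -> (forall v, 0 <= g v) ->
  2%:E * PI (fun v => g v * PI g v) 0%R = PI g 0%R * PI g 0%R.
Proof.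
move=> mg g0; pose G v := lam%:E * (chi (0 <= v)%R * g v).
have G0 v : 0 <= G v by rewrite !mule_ge0 ?chi_ge0// lee_fin ltW.
have mG : measurable_fun setT G.
  by apply: emeasurable_funM => //; apply: emeasurable_funM => //;
    exact: measurable_chi_le.
have cG b u v : 0 <= chi b * G u * G v.
  by apply: mule_ge0 => //; apply: mule_ge0 => //; exact: chi_ge0.
have m1 (c : R -> \bar R) : measurable_fun setT c ->
    measurable_fun [set: measurableTypeR R] (fun u => c u * G u).
  by move=> mc; apply: emeasurable_funM; [exact: mc|exact: mG].
have m2 (c : R -> \bar R) v : measurable_fun setT c ->
    measurable_fun [set: measurableTypeR R] (fun u => c u * G u * G v).
  by move=> mc; apply: emeasurable_funM; [exact: m1|].
have mle v : measurable_fun setT (fun u : R => chi (v <= u)%R : \bar R).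
  exact: measurable_chi_le.
have mge v : measurable_fun setT (fun u : R => chi (u <= v)%R : \bar R).
  exact: measurable_chi_le.
have mlt v : measurable_fun setT (fun u : R => chi (u < v)%R : \bar R).
  exact: measurable_chi_lt.
have mGG (c : R -> R -> \bar R) : 
    measurable_fun setT (fun p : measurableTypeR R * measurableTypeR R =>
      c p.1 p.2) ->
    measurable_fun setT (fun p : measurableTypeR R * measurableTypeR R =>
      c p.1 p.2 * G p.2 * G p.1).
  move=> mc; apply: emeasurable_funM; last exact: (measurableT_comp mG
    measurable_fst).
  by apply: emeasurable_funM => //; exact: (measurableT_comp mG measurable_snd).
have mle2 : measurable_fun [set: (measurableTypeR R * measurableTypeR R)%type]
    (fun p => chi ((p.1 : R) <= p.2)%R : \bar R).
  by apply: measurable_chi_le; [exact: measurable_fst|exact: measurable_snd].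
have mgt2 : measurable_fun [set: (measurableTypeR R * measurableTypeR R)%type]
    (fun p => chi ((p.2 : R) < p.1)%R : \bar R).
  by apply: measurable_chi_lt; [exact: measurable_snd|exact: measurable_fst].
have E1 : PI (fun v => g v * PI g v) 0%R =
    \int[mu]_v \int[mu]_u (chi (v <= u)%R * G u * G v).
  apply: eq_integral => v _; rewrite ge0_integralZr//; last 2 first.
  - exact: m1 (mle v).
  - by move=> *; rewrite mule_ge0 ?chi_ge0.
  case: (leP 0%R v) => v0; last first.
    by rewrite /G (_ : chi (0 <= v)%R = 0) ?mul0e ?mule0// chiE leNgt v0.
  rewrite (_ : \int[mu]_u _ = PI g v).
    by rewrite /G !chiE v0 !mul1e muleA muleC.
  apply: eq_integral => u _; rewrite /G !chiE; case: (leP v u) => vu.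
    by rewrite (le_trans v0 vu) !mul1e.
  by rewrite !mul0e mule0.
have E2 : PI (fun v => g v * PI g v) 0%R =
    \int[mu]_v \int[mu]_u (chi (u < v)%R * G u * G v).
  rewrite E1 [LHS]tonelli; last 2 first.
  - exact: (mGG (fun x y : R => chi (x <= y)%R)) mle2.
  - by move=> *; exact: cG.
  apply: eq_integral => v _; apply: ge0_ae_eq_integral => //.
  - have := m2 _ v (mge v); congr measurable_fun; apply/funext => u; exact: muleAC.
  - exact: m2 _ v (mlt v).
  exists [set v]; split => //; first exact: lebesgue_measure_set1.
  move=> u /= H; apply: contrapT => uv; apply: H => _.
  rewrite lt_neqAle (_ : u != v); last exact/eqP.
  by rewrite muleAC.
have -> : 2%:E * PI (fun v => g v * PI g v) 0%R =
    PI (fun v => g v * PI g v) 0%R + PI (fun v => g v * PI g v) 0%R.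
  by rewrite -[2%R]/(1 + 1)%R EFinD ge0_muleDl ?lee_fin// mul1e.
rewrite {1}E1 E2 -ge0_integralD//; last 4 first.
- by move=> v _; apply: integral_ge0 => u _; exact: cG.
- apply: (@measurable_ge0_integral _ _ (measurableTypeR R) (measurableTypeR R) R mu
    (fun v u => chi (v <= u)%R * G u * G v)) => [|*]; last exact: cG.
  exact: (mGG (fun x y : R => chi (x <= y)%R)) mle2.
- by move=> v _; apply: integral_ge0 => u _; exact: cG.
- apply: (@measurable_ge0_integral _ _ (measurableTypeR R) (measurableTypeR R) R mu
    (fun v u => chi (u < v)%R * G u * G v)) => [|*]; last exact: cG.
  exact: (mGG (fun x y : R => chi (y < x)%R)) mgt2.
transitivity (\int[mu]_v (PI g 0%R * G v)); last first.
  by rewrite ge0_integralZl// ?poisson_intensity_ge0//.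
apply: eq_integral => v _.
rewrite -ge0_integralD//; last 2 first.
- exact: m2 _ v (mle v).
- exact: m2 _ v (mlt v).
rewrite -ge0_integralZr//; last by move=> u _; exact: G0.
apply: eq_integral => u _; rewrite -/(G u) -!muleA -ge0_muleDl ?chi_ge0//.
by rewrite !chiE ltNge; case: (_ <= _)%R; rewrite ?adde0 ?add0e mul1e.
Qed.

(** The number of jobs in the infinite-server queue is Poisson distributed; the
    part of this used here is that its second factorial moment is at most the
    square of its mean. *)
Lemma sum_unfinished_pairs_le t : (0 <= t)%R ->
  2%:E * \sum_(0 <= i <oo) \sum_(0 <= l <oo)
    \int[P]_w (chi (unfinished t i w) * chi (unfinished t (i.+1 + l) w)) <=
  mean_unfinished t * mean_unfinished t.
Proof.
move=> t0; rewrite /mean_unfinished.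
rewrite -(poisson_intensity_square (measurable_remaining_prob t)
  (remaining_prob_ge0 t)).
apply: lee_wpmul2l => //.
apply: (@le_trans _ _ (\sum_(0 <= i <oo)
    \int[P]_w (remaining_prob t (arrival i w) * PIr t (arrival i w)))).
  apply: lee_nneseries => [i _ _|i _]; last exact: sum_unfinished_pair_le.
  by apply: nneseries_ge0 => *; apply: integral_ge0 => *; rewrite mule_ge0 ?chi_ge0.
apply: arrival_intensity_le.
  exact: (emeasurable_funM (measurable_remaining_prob t) (mPIr t)).
by move=> v; apply: mule_ge0; [exact: remaining_prob_ge0|exact: PIr0].
Qed.

Lemma window_measure (t z : R) : (0 <= t)%R ->
  \int[mu]_v chi ((0 <= v)%R && ((v <= t)%R && (t < v + z)%R)) =
  (Num.min (Num.max z 0) t)%:E.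
Proof.
move=> t0; case: (ltP t z) => tz.
  have z0 : (0 <= z)%R by rewrite (le_trans t0)// ltW.
  rewrite (max_idPl z0) (min_idPr (ltW tz)) -[RHS]integral_chi_itv//.
  apply: eq_integral => v _; congr chi; apply/andP/andP => -[v0].
    by case/andP.
  by move=> vt; rewrite vt/= ltr_wpDl.
rewrite integral_chi; last first.
  apply: measurable_and; first exact: measurable_fun_ler.
  exact: measurable_window.
rewrite (_ : [set _ | _] = `](t - z)%R, t]%classic); last first.
  apply/seteqP; split=> v /=; rewrite in_itv/= ltrBlDr.
    by move=> /and3P[_ -> ->].
  move=> /andP[tv vt]; rewrite tv vt !andbT.
  by rewrite ltW// (le_lt_trans _ (_ : t - z < v)%R) ?subr_ge0// ltrBlDr.
rewrite /= lebesgue_measure_itv/= lte_fin ltrBlDr ltrDl.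
case: ltP => z0.
  by rewrite (min_idPl tz) -EFinB; congr EFin; ring.
by rewrite (min_idPl t0).
Qed.

Lemma mean_unfinishedE t : (0 <= t)%R ->
  mean_unfinished t = lam%:E * \int[sig]_z (Num.min (Num.max z 0) t)%:E.
Proof.
move=> t0; rewrite /mean_unfinished /poisson_intensity.
rewrite ge0_integralZl_EFin//; last 3 first.
- by move=> v _; rewrite mule_ge0 ?chi_ge0 ?remaining_prob_ge0.
- apply: emeasurable_funM; last exact: measurable_remaining_prob.
  exact: measurable_chi_le.
- exact: ltW.
congr (_ * _).
pose b (v z : R) : bool := (0 <= v)%R && ((v <= t)%R && (t < v + z)%R).
transitivity (\int[mu]_v \int[sig]_z chi (b v z)).
  apply: eq_integral => v _; rewrite /remaining_prob /b.
  case: (0 <= v)%R => /=; first by rewrite chiE mul1e.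
  by rewrite chiE mul0e integral0_eq// => z _; rewrite chiE.
rewrite tonelli; last 2 first.
- apply: measurable_chi; apply: measurable_and;
    first by apply: measurable_fun_ler => //.
  by apply: measurable_window => //; exact: measurable_fst.
- by move=> *; exact: chi_ge0.
by apply: eq_integral => z _; rewrite window_measure.
Qed.

(** As in Wald's identity, the service time of job [k] is independent of its
    arrival time, so the expected work is [ES] per expected arrival. *)
Lemma arrived_work_le (ES t : R) : (0 <= t)%R ->
  \int[sig]_z (Num.max z 0)%:E = ES%:E ->
  \sum_(0 <= k <oo) \int[P]_w ((Num.max (s k w) 0)%:E * chi (arrival k w <= t)%R) <=
  (ES * (lam * t))%:E.
Proof.
move=> t0 ESE; have mmax : measurable_fun setT (fun z : R => (Num.max z 0)%:E).
  by apply/measurable_EFinP; exact: measurable_maxr.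
have max0 (z : R) : 0 <= (Num.max z 0)%:E by rewrite lee_fin le_max lexx orbT.
have E k : \int[P]_w ((Num.max (s k w) 0)%:E * chi (arrival k w <= t)%R) =
    ES%:E * P [set w | (arrival k w <= t)%R].
  have Uk : ~~ used_variables pred0 0 k.+1 (inr k : nat + nat) by [].
  have := integral_independent_pair (f := fun x z : R =>
    (Num.max z 0)%:E * chi (x <= t)%R)
    Uk (independent_outside_arrival k) (sE k).
  move=> H; rewrite [LHS]H; last 2 first.
  - apply: emeasurable_funM; first exact: (measurableT_comp mmax measurable_snd).
    by apply: measurable_chi_le.
  - by move=> *; rewrite mule_ge0 ?chi_ge0.
  rewrite -ESE -integral_arrival_le -ge0_integralZl//; last 3 first.
  - by apply: measurable_chi_le => //; exact: measurable_arrival.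
  - by move=> *; exact: chi_ge0.
  - exact: integral_ge0.
  apply: eq_integral => w _; rewrite ge0_integralZr ?chi_ge0//.
under eq_eseriesr do rewrite E.
rewrite nneseriesZl; last by move=> *; exact: measure_ge0.
rewrite EFinM; apply: lee_wpmul2l; last exact: expected_arrivals_le.
by rewrite -ESE; exact: integral_ge0.
Qed.

End poisson_arrivals.

(** * Sample paths of the queue started empty *)

Local Close Scope ereal_scope.

Section empty_start.
Context (R : realType) (n : nat).

Definition empty_system : initial_condition R n :=
  @InitialCondition R n [::] 0 isT (leq0n n) (fun h => False_ind _ (notF h)).

Variables (a s : nat -> R).
Notation T := (arrival_time empty_system a).
Notation F := (server_free empty_system a s).
Notation start := (start_time empty_system a s).
Notation dep := (departure_time empty_system a s).

Lemma arrival_timeE k : T k = \sum_(i < k.+1) a i.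
Proof. by []. Qed.

Lemma departure_timeE k : dep k = start k + s k.
Proof. by rewrite /departure_time /service_time /= subn0. Qed.

Lemma server_freeS k : F k.+1 = sort <=%R (dep k :: behead (F k)).
Proof. by []. Qed.

Lemma sorted_server_free k : sorted <=%R (F k).
Proof.
case: k => [|k]; last exact/sort_sorted/le_total.
rewrite /=; case: n => // m /=; elim: m => //= m IH.
by rewrite lexx.
Qed.

Hypothesis n_gt0 : (0 < n)%N.

Lemma size_server_free k : size (F k) = n.
Proof.
elim: k => [|k IH]; first by rewrite size_nseq.
by rewrite server_freeS size_sort /= size_behead IH prednK.
Qed.

Lemma arrival_le_start k : T k <= start k.
Proof. by rewrite le_max lexx. Qed.

(** Every step replaces one entry of the list by the departure time of the new
    job, so each server free only after [t] accounts for such a departure. *)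
Lemma count_server_free (t : R) k :
  (count (> t)%R (F k) <= \sum_(i < k) (t < dep i)%R + count (> t)%R (F 0))%N.
Proof.
elim: k => [|k IH]; first by rewrite big_ord0.
rewrite server_freeS (permP (permEl (perm_sort _ _)))
  /= big_ord_recr/= addnAC addnC leq_add2r.
apply: leq_trans IH; case: (F k) => //= c l.
by rewrite leq_addl.
Qed.

Variable t : R.
Hypothesis t_ge0 : 0 <= t.
Hypothesis a_ge0 : forall i, 0 <= a i.

Lemma le_arrival_time i j : (i <= j)%N -> T i <= T j.
Proof.
move=> /subnKC <-; elim: (j - i)%N => [|m IH]; first by rewrite addn0.
apply: le_trans IH _; rewrite addnS !arrival_timeE.
by rewrite [leRHS]big_ord_recr/= lerDl.
Qed.

(** Consider the first [m] at which all the servers are free only after [t].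
    The jobs before [m] have started by [t], and by [count_server_free] at least
    [n] of them depart after [t]. *)
Lemma all_servers_busy k : T k <= t -> t < start k ->
  (n <= \sum_(i < k) ((start i <= t)%R && (t < dep i)%R))%N.
Proof.
move=> Tk tk.
have head_k : t < head 0 (F k).
  by move: tk; rewrite /start_time lt_max ltNge Tk.
have ex : exists m, t < head 0 (F m) by exists k.
case: (ex_minnP ex) => m tm min_m.
have mk : (m <= k)%N by exact: min_m.
have started i : (i < m)%N -> start i <= t.
  move=> im; rewrite ge_max (le_trans (le_arrival_time _) Tk)/=; last first.
    exact: leq_trans (ltnW im) mk.
  by rewrite leNgt; apply/negP => /min_m; rewrite leqNgt im.
have all_m : count (> t)%R (F m) = n.
  rewrite -[RHS](size_server_free m); apply/eqP; rewrite -all_count.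
  have := sorted_server_free m; case: (F m) tm => //= c l tc.
  rewrite (path_sortedE le_trans) => /andP[/allP cl _].
  by rewrite tc; apply/allP => x /cl; exact: lt_le_trans.
have count0 : count (> t)%R (F 0) = 0%N.
  apply/eqP; rewrite -leqn0 leqNgt -has_count; apply/hasPn => x.
  by rewrite mem_nseq => /andP[_ /eqP->]; rewrite /= -leNgt.
have := count_server_free t m; rewrite all_m count0 addn0 => /leq_trans; apply.
apply: (@leq_trans (\sum_(i < m) ((start i <= t)%R && (t < dep i)%R))%N).
  by apply: leq_sum => i _; rewrite started.
rewrite -!(big_mkord xpredT (fun i => nat_of_bool ((start i <= t)%R && (t < dep
  i)%R))).
by rewrite [leqRHS](big_cat_nat (n := m))//= leq_addr.
Qed.

Variable K : nat.
Hypothesis TK : t < T K.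

Lemma arrived_lt k : T k <= t -> (k < K)%N.
Proof.
by move=> Tk; rewrite ltnNge; apply/negP => /le_arrival_time /le_trans /(_ Tk);
  rewrite leNgt TK.
Qed.

(** Either some job has arrived but not started, and all servers are busy, or
    every arrived job has started, and none leaves before it would leave an
    infinite-server queue. *)
Lemma in_service_ge_unfinished :
  (minn n (\sum_(k < K) ((T k <= t)%R && (t < T k + s k)%R)) <=
   \sum_(k < K) ((start k <= t)%R && (t < dep k)%R))%N.
Proof.
have [[k [Tk tk]]|] := pselect (exists k, T k <= t /\ t < start k).
  apply: leq_trans (geq_minl _ _) _; apply: leq_trans (all_servers_busy Tk tk) _.
  rewrite -!(big_mkord xpredT (fun i => nat_of_bool ((start i <= t)%R && (t <
    dep i)%R))).
  by rewrite [leqRHS](big_cat_nat (n := k))//= ?leq_addr// ltnW// arrived_lt.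
move=> /forallNP H; apply: leq_trans (geq_minr _ _) _.
apply: leq_sum => k _; case: (leP (T k) t) => //= Tk.
have st : start k <= t by rewrite leNgt; apply/negP => tk; apply: (H k).
rewrite st departure_timeE /=; case: ltP => // tTs; case: ltP => //.
by rewrite leNgt (lt_le_trans tTs)// lerD2r arrival_le_start.
Qed.

Lemma card_jobs_in_service :
  #|` jobs_in_service empty_system a s t|%fset =
  (\sum_(k < K) ((start k <= t)%R && (t < dep k)%R))%N.
Proof.
rewrite /jobs_in_service; set p := fun k => (start k <= t)%R && (t < dep k)%R.
have pK k : p k -> (k < K)%N.
  by move=> /andP[+ _] => /(le_trans (arrival_le_start k)); exact: arrived_lt.
have fin : finite_set [set k | p k].
  by apply: (sub_finite_set (B := `I_K)); [move=> k /pK|exact: finite_II].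
have -> : (\sum_(k < K) p k)%N = size [seq k <- iota 0 K | p k].
  rewrite -(big_mkord xpredT (fun k => nat_of_bool (p k))) size_filter -sum1_count.
  by rewrite [RHS]big_mkcond/= /index_iota subn0; apply: eq_bigr => k _;
    case: (p k).
apply/perm_size/uniq_perm; first exact: fset_uniq.
  by rewrite filter_uniq// iota_uniq.
move=> k; rewrite mem_filter mem_iota add0n /=.
have -> : (k \in fset_set [set k | p k]) = p k.
  by rewrite in_fset_set//; apply/idP/idP; rewrite inE.
by case pk: (p k); rewrite //= pK.
Qed.

Lemma nonzero_service_vector (i : 'I_n) :
  service_vector empty_system a s t ord0 i != 0 ->
  (i < #|` jobs_in_service empty_system a s t|%fset)%N.
Proof.
rewrite mxE; apply: contraNT; rewrite -leqNgt => Ni; apply/eqP/nth_default.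
by rewrite size_sort size_map.
Qed.

End empty_start.

(** * Measurability and occupation times *)

Section order_statistics.
Context (R : realType).

Lemma lt_nth_sorted (l : seq R) (y : R) i : sorted <=%R l -> (i < size l)%N ->
  (y < nth 0 l i) = (count (<= y)%R l <= i)%N.
Proof.
elim: l i => // c l IH i /[dup] /path_sorted sl /=.
rewrite (path_sortedE le_trans) => /andP[/allP cl _].
case: (leP c y) => cy il.
  case: i il => [|i] il /=; first by rewrite ltNge cy.
  by rewrite add1n ltnS IH.
rewrite add0n (_ : count _ l = 0%N).
  by case: i il => [|i] il //=; rewrite (lt_le_trans cy)// cl// mem_nth.
apply/eqP; rewrite -leqn0 leqNgt -has_count; apply/hasPn => x /cl cx.
by rewrite /= -ltNge (lt_le_trans cy).
Qed.

(** The entry of rank [i], counted from 0, exceeds [y] if and only if at most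
    [i] entries are [<= y], and the number of such entries is measurable. *)
Lemma measurable_nth_sort d (T : measurableType d) n (l : T -> seq R) i :
  (forall w, size (l w) = n) ->
  (forall j, measurable_fun setT (fun w => nth 0 (l w) j)) ->
  measurable_fun setT (fun w => nth 0 (sort <=%R (l w)) i).
Proof.
move=> sl ml; case: (ltnP i n) => [i_n|n_i]; last first.
  rewrite (_ : (fun _ => _) = fun=> 0)//; apply/funext => w.
  by rewrite nth_default// size_sort sl.
move=> _; apply: (measurability _ (RGenOInfty.measurableE R)) => //.
move=> /= _ [_ [y ->] <-]; rewrite setTI.
pose cnt w : R := \sum_(j < n) (nth 0 (l w) j <= y)%R%:R.
have cntE w : (count (<= y)%R (l w))%:R = cnt w.
  rewrite -sum1_count big_mkcond /= (big_nth 0) sl big_mkord natr_sum.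
  by apply: eq_bigr => j _; case: (_ <= _).
rewrite (_ : _ @^-1` _ = [set w | cnt w <= i%:R]).
  apply: measurable_boolset; apply: measurable_fun_ler => //.
  apply: measurable_sum => j.
  rewrite (_ : (fun _ => _) = fun w => if nth 0 (l w) j <= y then 1 else 0 : R).
    apply: measurable_fun_ifT => //; exact: measurable_fun_ler.
  by apply/funext => w; case: (_ <= _).
apply/seteqP; split=> w /=; rewrite in_itv/= andbT lt_nth_sorted//.
- by rewrite -cntE ler_nat (permP (permEl (perm_sort _ _))).
- exact/sort_sorted/le_total.
- by rewrite size_sort sl.
- by rewrite -cntE ler_nat (permP (permEl (perm_sort _ _))).
- exact/sort_sorted/le_total.
- by rewrite size_sort sl.
Qed.

End order_statistics.

Section queue.
Context d (Omega : measurableType d) (R : realType) (P : probability Omega R).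
Context (n : nat) (a s : nat -> {RV P >-> R}).
Hypothesis n_gt0 : (0 < n)%N.

Notation e := (empty_system R n).

Definition start (k : nat) (w : Omega) : R :=
  start_time e (fun i => a i w) (s ^~ w) k.
Definition depart (k : nat) (w : Omega) : R :=
  departure_time e (fun i => a i w) (s ^~ w) k.

Lemma departE k w : depart k w = start k w + s k w.
Proof. exact: departure_timeE. Qed.

Lemma measurable_server_free k i :
  measurable_fun setT (fun w => nth 0 (server_free e (fun i =>
    a i w) (s ^~ w) k) i).
Proof.
elim: k i => [|k IH] i.
  by rewrite (_ : (fun _ => _) = fun=> nth 0 (nseq n 0) i).
apply: (measurable_nth_sort (n := n)) => [w|[|j]] /=.
- by rewrite size_behead size_server_free// prednK.
- apply: measurable_funD; last exact: (measurable_funP (s (k - 0)%N)).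
  apply: measurable_maxr.
    exact: (measurable_arrival a k).
  by under eq_fun do rewrite -nth0; exact: IH.
- by under eq_fun do rewrite nth_behead; exact: IH.
Qed.

Lemma measurable_start k : measurable_fun setT (start k).
Proof.
apply: measurable_maxr; first exact: (measurable_arrival a k).
rewrite (_ : (fun _ => _) = fun w => nth 0 (server_free e (fun i =>
  a i w) (s ^~ w) k) 0).
  exact: measurable_server_free.
by apply/funext => w; rewrite nth0.
Qed.

Lemma measurable_depart k : measurable_fun setT (depart k).
Proof.
rewrite (_ : depart k = fun w => start k w + s k w).
  by apply: measurable_funD => //; exact: measurable_start.
by apply/funext => w; rewrite departE.
Qed.

Definition serving (t : R) (k : nat) (w : Omega) : bool :=
  (start k w <= t) && (t < depart k w).

Lemma measurable_serving t k : measurable_fun setT (serving t k).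
Proof.
apply: measurable_and.
  by apply: measurable_fun_ler => //; exact: measurable_start.
by apply: measurable_fun_ltr => //; exact: measurable_depart.
Qed.

Local Open Scope ereal_scope.
Notation mu := (@lebesgue_measure R).

(** A job occupies a server for its service time, and only after its arrival. *)
Lemma busy_time_le (tau : R) k w :
  \int[mu]_t (chi ((0 <= t)%R && (t <= tau)%R) * chi (serving t k w)) <=
  (Num.max (s k w) 0)%:E * chi (arrival a k w <= tau)%R.
Proof.
rewrite chiE; case: ifP => [_|/negbT atau]; last first.
  rewrite mule0 integral0_eq// => t _; rewrite -chi_and chiE ifF//.
  apply/negbTE; apply: contra atau => /andP[/andP[_ ttau] /andP[st _]].
  apply: le_trans ttau; apply: le_trans st.
  exact: arrival_le_start.
rewrite mule1.
have mserving : measurable_fun setT (fun t : R =>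
  (start k w <= t)%R && (t < depart k w)%R).
  by apply: measurable_and; [exact: measurable_fun_ler|exact: measurable_fun_ltr].
apply: (@le_trans _ _ (\int[mu]_t chi ((start k w <= t)%R && (t < depart k w)%R))).
  apply: ge0_le_integral => //.
  - by move=> *; rewrite mule_ge0 ?chi_ge0.
  - under eq_fun do rewrite -chi_and.
    apply: measurable_chi; apply: measurable_and => //.
    by apply: measurable_and; exact: measurable_fun_ler.
  - exact: measurable_chi.
  - by move=> t _; rewrite -chi_and; apply: le_chi => /andP[].
rewrite integral_chi// (_ : [set _ | _] = `[start k w, depart k w[%classic);
  last first.
  by apply/seteqP; split=> x /=; rewrite in_itv/=.
rewrite /= lebesgue_measure_itv/= lte_fin departE ltrDl.
case: ltP => s0.
  by rewrite -EFinB lee_fin addrC addKr.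
by [].
Qed.

End queue.

(** * The excess at a fixed time *)

Local Open Scope ereal_scope.

(** Up to the terms with [i.+1 + l >= K], this is the square of a sum of
    idempotents; the extra terms let both indices range over [K]. *)
Lemma square_sum_bool (b : nat -> bool) K :
  ((\sum_(k < K) b k) ^ 2 <=
   \sum_(k < K) b k + 2 * \sum_(i < K) \sum_(l < K) (b i && b (i.+1 + l)))%N.
Proof.
pose D := (fun K => \sum_(j < K) \sum_(i < j) (b i && b j))%N.
have sq : ((\sum_(k < K) b k) ^ 2 = \sum_(k < K) b k + 2 * D K)%N.
  rewrite {}/D; elim: K => [|K IH]; first by rewrite !big_ord0.
  rewrite big_ord_recr/= sqrnD IH big_ord_recr/= mulnDr.
  have -> : (\sum_(i < K) (b i && b K) = (\sum_(k < K) b k) * b K)%N.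
    by rewrite big_distrl/=; apply: eq_bigr => i _; rewrite mulnb.
  by case: (b K); rewrite /= ?muln1 ?muln0; lia.
rewrite sq leq_add2l leq_mul2l /= {sq}/D.
have -> : (\sum_(j < K) \sum_(i < j) (b i && b j) =
    \sum_(i < K) \sum_(j < K | i < j) (b i && b j))%N.
  transitivity (\sum_(j < K) \sum_(i < K | i < j) (b i && b j))%N.
    apply: eq_bigr => j _; rewrite (big_ord_widen _ (fun i =>
      nat_of_bool (b i && b j)) (ltnW (ltn_ord j)))//.
  by rewrite (exchange_big_dep xpredT).
apply: leq_sum => i _.
rewrite -(big_mkord (fun j => i < j)%N (fun j => nat_of_bool (b i && b j))).
rewrite -(big_mkord xpredT (fun l => nat_of_bool (b i && b (i.+1 + l)%N))).
rewrite (@big_cat_nat _ _ _ i.+1)//= big_nat_cond big1 ?add0n; last first.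
  by move=> j /andP[/andP[_ ji] ij]; rewrite ltnNge -ltnS ji in ij.
rewrite -{1}[i.+1]add0n big_addn.
apply: (@leq_trans (\sum_(0 <= l < K - i.+1) (b i && b (i.+1 + l)))%N).
  by rewrite big_mkcond/=; apply: leq_sum => l _; rewrite addnC; case: ifP.
by rewrite [leqRHS](@big_cat_nat _ _ _ (K - i.+1))//= ?leq_addr ?leq_subr.
Qed.

Section steady_state.
Context d (Omega : measurableType d) (R : realType) (P : probability Omega R).
Context (n : nat) (a s : nat -> {RV P >-> R}) (lam ES : R)
  (nu sig : probability R R).
Hypothesis n_gt0 : (0 < n)%N.
Hypothesis lam_gt0 : (0 < lam)%R.
Hypothesis nuE : forall B : set R, measurable B -> nu B = exponential_prob lam B.
Hypothesis aE : forall k (B : set R), measurable B -> distribution P (a k) B = nu B.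
Hypothesis sE : forall k (B : set R), measurable B -> distribution P (s k)
  B = sig B.
Hypothesis indep : independent_sequences a s.
Hypothesis ESE : \int[sig]_z (Num.max z 0)%:E = ES%:E.
Notation mu := (@lebesgue_measure R).

Definition mean_serving (t : R) : \bar R :=
  \sum_(0 <= k <oo) \int[P]_w chi (serving n a s t k w).

Let mserving2 k : measurable_fun setT
  (fun p : measurableTypeR R * Omega => chi (serving n a s p.1 k p.2) : \bar R).
Proof.
apply: measurable_chi; apply: measurable_and.
  apply: measurable_fun_ler; last exact: measurable_fst.
  exact: (measurableT_comp (measurable_start a s n_gt0 k) measurable_snd).
apply: measurable_fun_ltr; first exact: measurable_fst.
exact: (measurableT_comp (measurable_depart a s n_gt0 k) measurable_snd).
Qed.

Lemma mean_serving_ge0 t : 0 <= mean_serving t.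
Proof.
by apply: nneseries_ge0 => *; apply: integral_ge0 => *; exact: chi_ge0.
Qed.

Lemma measurable_mean_serving : measurable_fun [set: measurableTypeR R]
  mean_serving.
Proof.
apply: ge0_emeasurable_sum => [k t _ _|k _].
  by apply: integral_ge0 => *; exact: chi_ge0.
apply: (@measurable_ge0_integral _ _ (measurableTypeR R) Omega R P
  (fun t w => chi (serving n a s t k w))); first exact: mserving2.
by move=> *; exact: chi_ge0.
Qed.

(** Server time before [tau] is spent on jobs that have arrived by [tau], so it
    is at most the work that they bring. *)
Lemma busy_time_total (tau : R) : (0 <= tau)%R ->
  \int[mu]_t (chi ((0 <= t)%R && (t <= tau)%R) * mean_serving t) <=
  (ES * (lam * tau))%:E.
Proof.
move=> tau0.
have mwin : measurable_fun [set: measurableTypeR R]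
    (fun t : R => chi ((0 <= t)%R && (t <= tau)%R) : \bar R).
  by apply: measurable_chi; apply: measurable_and; exact: measurable_fun_ler.
have mk k : measurable_fun setT
    (fun p : measurableTypeR R * Omega =>
     chi ((0 <= p.1 :> R)%R && (p.1 <= tau)%R) * chi (serving n a s p.1 k p.2)
       : \bar R).
  apply: emeasurable_funM; last exact: (mserving2 k).
  exact: (measurableT_comp mwin measurable_fst).
have E t : chi ((0 <= t)%R && (t <= tau)%R) * mean_serving t = \sum_(0 <= k <oo)
    \int[P]_w (chi ((0 <= t)%R && (t <= tau)%R) * chi (serving n a s t k w)).
  rewrite -nneseriesZl; last first.
    by move=> *; apply: integral_ge0 => *; exact: chi_ge0.
  apply: eq_eseriesr => k _; rewrite ge0_integralZl_EFin//.
  - by move=> *; exact: chi_ge0.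
  - by apply: measurable_chi; exact: measurable_serving.
under eq_integral do rewrite E.
rewrite integral_nneseries//; last 2 first.
- move=> k; apply: (@measurable_ge0_integral _ _ (measurableTypeR R) Omega R P
    (fun t w => chi ((0 <= t)%R && (t <= tau)%R) * chi (serving n a s t k w))).
    exact: mk.
  by move=> *; rewrite mule_ge0 ?chi_ge0.
- by move=> k t _; apply: integral_ge0 => *; rewrite mule_ge0 ?chi_ge0.
apply: le_trans (arrived_work_le lam_gt0 nuE aE sE indep tau0 ESE).
apply: lee_nneseries => [k _ _|k _].
  by apply: integral_ge0 => *; apply: integral_ge0 => *; rewrite mule_ge0 ?chi_ge0.
rewrite tonelli; last 2 first.
- exact: mk.
- by move=> *; rewrite mule_ge0 ?chi_ge0.
apply: ge0_le_integral => //.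
- by move=> *; apply: integral_ge0 => *; rewrite mule_ge0 ?chi_ge0.
- apply: (@measurable_ge0_integral _ _ Omega (measurableTypeR R) R mu
    (fun w t => chi ((0 <= t)%R && (t <= tau)%R) * chi (serving n a s t k w))).
    have mswap : measurable_fun setT
        (fun p : Omega * measurableTypeR R => (p.2, p.1)).
      by apply: measurable_fun_pair; [exact: measurable_snd|exact: measurable_fst].
    exact: (measurableT_comp (mk k) mswap).
  by move=> *; rewrite mule_ge0 ?chi_ge0.
- apply: emeasurable_funM.
    by apply/measurable_EFinP; apply: measurable_maxr.
  by apply: measurable_chi_le => //; exact: measurable_arrival.
- by move=> w _; exact: busy_time_le.
Qed.

Import HBNNSimple.

(** The integral is the supremum over the simple functions below [f].  This
    reduces an upper bound for a functional of the sorted vector of residual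
    service times, not known to be measurable, to measurable functions. *)
Lemma ge0_integral_le_simple (f : Omega -> \bar R) (B : \bar R) :
  (forall w, 0 <= f w) ->
  (forall h : {nnsfun Omega >-> R}, (forall w, (h w)%:E <= f w) ->
    \int[P]_w (h w)%:E <= B) ->
  \int[P]_w f w <= B.
Proof.
move=> f0 H; rewrite ge0_integralTE//; apply: ge_ereal_sup => _ [h /= hf <-].
have := H h hf; rewrite integral_nnsfun//.
by rewrite patch_setT.
Qed.

Section fixed_time.
Variables (t r c m : R).
Hypothesis t_ge0 : (0 <= t)%R.
Hypothesis r_ge0 : (0 <= r)%R.
Hypothesis r_le_n : (r <= n%:R)%R.
Hypothesis c_gt0 : (0 < c)%R.
Hypothesis mE : mean_unfinished lam sig t = m%:E.

Let N w : nat := #|` jobs_in_service (empty_system R n) (fun i =>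
  a i w) (s ^~ w) t|%fset.
Let Nhat w : \bar R := \sum_(0 <= k <oo) chi (serving n a s t k w).
Let Mhat w : \bar R := \sum_(0 <= k <oo) chi (unfinished a s t k w).
Let Dhat w : \bar R := \sum_(0 <= i <oo) \sum_(0 <= l <oo)
  (chi (unfinished a s t i w) * chi (unfinished a s t (i.+1 + l) w)).

Let al : R := ((r + c) / (2 * c))%R.
Let be : R := ((4 * c)^-1)%R.

(** Since [r <= n], a number [N'] in service that is at least [min n M]
    satisfies [(r - N')^+ <= (r - M)^+].  The inequality is then
    [N' - r + (r - N')^+ = (N' - r)^+] together with
    [z^+ <= (z + c)^2 / (4 * c)], expanded so that all random terms have a plus
    sign on the side where they stand. *)
Lemma positive_part_le (x M N' : R) : (0 <= M)%R ->
  (Num.min n%:R M <= N')%R -> (x <= Num.max (N' - r) 0)%R ->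
  (x + r + al * M <= N' + be * (M ^+ 2 + (r + c) ^+ 2))%R.
Proof.
move=> M0 MN xN.
have H (y : R) : (y <= Num.max (r - M) 0)%R -> (y + al * M <= be * (M ^+ 2 + (r
  + c) ^+ 2))%R.
  move=> yM.
  have -> : (be * (M ^+ 2 + (r + c) ^+ 2) = be * (r - M + c) ^+ 2 + al * M)%R.
    by rewrite /be /al; field; rewrite gt_eqF.
  rewrite lerD2r; apply: le_trans yM _.
  rewrite mulrC ler_pdivlMr ?mulr_gt0//.
  rewrite le_max in xN; case: (leP (r - M)%R 0%R) => rM.
    by rewrite mul0r sqr_ge0.
  rewrite -subr_ge0 (_ : _ - _ = (r - M - c) ^+ 2)%R ?sqr_ge0//; ring.
have := H (Num.max (r - N') 0)%R.
have rNM : (Num.max (r - N') 0 <= Num.max (r - M) 0)%R.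
  rewrite ge_max !le_max lexx orbT andbT.
  case: (leP n%:R M) MN => nM MN; apply/orP; [right|left].
    by rewrite subr_le0 (le_trans r_le_n).
  by rewrite lerD2l lerN2.
move=> /(_ rNM) H'.
apply: (@le_trans _ _ (N' + (Num.max (r - N') 0 + al * M))%R);
  last by rewrite lerD2l.
rewrite addrA lerD2r.
apply: (@le_trans _ _ (Num.max (N' - r) 0 + r)%R); first by rewrite lerD2r.
by case: (leP (N' - r) 0)%R => h1; case: (leP (r - N') 0)%R => h2; lra.
Qed.

Let munf k : measurable_fun setT (fun w => chi (unfinished a s t k w) : \bar R).
Proof. by apply: measurable_chi; exact: measurable_unfinished. Qed.

Let mser k : measurable_fun setT (fun w => chi (serving n a s t k w) : \bar R).
Proof. by apply: measurable_chi; exact: measurable_serving. Qed.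

Let mNhat : measurable_fun setT Nhat.
Proof. by apply: ge0_emeasurable_sum => *; [exact: chi_ge0|exact: mser]. Qed.

Let mMhat : measurable_fun setT Mhat.
Proof. by apply: ge0_emeasurable_sum => *; [exact: chi_ge0|exact: munf]. Qed.

Let mDi i : measurable_fun setT (fun w => \sum_(0 <= l <oo)
  (chi (unfinished a s t i w) * chi (unfinished a s t (i.+1 + l) w)) : \bar R).
Proof.
apply: ge0_emeasurable_sum => [*|l _]; first by rewrite mule_ge0 ?chi_ge0.
exact: emeasurable_funM.
Qed.

Let Di0 i w : 0 <= \sum_(0 <= l <oo)
  (chi (unfinished a s t i w) * chi (unfinished a s t (i.+1 + l) w) : \bar R).
Proof. by apply: nneseries_ge0 => *; rewrite mule_ge0 ?chi_ge0. Qed.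

Let mDhat : measurable_fun setT Dhat.
Proof. by apply: ge0_emeasurable_sum => *; [exact: Di0|exact: mDi]. Qed.

Let Nhat0 w : 0 <= Nhat w.
Proof. by apply: nneseries_ge0 => *; exact: chi_ge0. Qed.
Let Mhat0 w : 0 <= Mhat w.
Proof. by apply: nneseries_ge0 => *; exact: chi_ge0. Qed.
Let Dhat0 w : 0 <= Dhat w.
Proof. by apply: nneseries_ge0 => *; exact: Di0. Qed.

Let intN : \int[P]_w Nhat w = mean_serving t.
Proof. by rewrite integral_nneseries// => *; exact: chi_ge0. Qed.

Let intM : \int[P]_w Mhat w = m%:E.
Proof.
rewrite integral_nneseries//; last by move=> *; exact: chi_ge0.
by rewrite -mE -(sum_unfinished_prob lam_gt0 nuE aE sE indep).
Qed.

Let intD : 2%:E * \int[P]_w Dhat w <= (m ^+ 2)%:E.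
Proof.
rewrite integral_nneseries//.
under eq_eseriesr => i _.
  rewrite integral_nneseries//; last 2 first.
  - by move=> l; exact: emeasurable_funM.
  - by move=> *; rewrite mule_ge0 ?chi_ge0.
  over.
apply: le_trans (sum_unfinished_pairs_le lam_gt0 nuE aE sE indep t_ge0) _.
by rewrite mE -EFinM expr2.
Qed.

Let chi_sum (b : nat -> bool) K :
  \sum_(0 <= k < K) chi (b k) = ((\sum_(k < K) b k)%N%:R)%:E :> \bar R.
Proof.
by rewrite big_mkord sumEFin natr_sum.
Qed.

Let pointwise : {ae P, forall w (h : R), (h <= Num.max ((N w)%:R - r) 0)%R ->
  (h + r)%:E + al%:E * Mhat w <=
  Nhat w + be%:E * (Mhat w + 2%:E * Dhat w + ((r + c) ^+ 2)%:E)}.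
Proof.
have be0 : (0 <= be)%R by rewrite invr_ge0 mulr_ge0// ltW.
have ae1 := interarrival_ge0 nuE aE.
have ae2 := arrivals_unbounded lam_gt0 nuE aE indep t_ge0.
apply: filterS2 ae1 ae2 => w a0 [K tK] h hN.
pose bM k := unfinished a s t k w.
have bMK k : bM k -> (k < K)%N.
  by move=> /andP[+ _]; exact: (arrived_lt (n := n) (a := fun i => a i w) a0 tK).
pose M := (\sum_(k < K) bM k)%N.
pose D := (\sum_(i < K) \sum_(l < K) (bM i && bM (i.+1 + l)))%N.
have ME : Mhat w = M%:R%:E.
  rewrite /Mhat (nneseries_split 0 K); last by move=> *; exact: chi_ge0.
  rewrite add0n chi_sum eseries0 ?adde0// => k Kk _.
  rewrite chiE ifF//; apply/negbTE; apply: contraL Kk => /bMK.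
  by rewrite -ltnNge.
have NE : N w = (\sum_(k < K) serving n a s t k w)%N.
  exact: (card_jobs_in_service (s ^~ w) (a := fun i => a i w) a0 tK).
have NN : (N w)%:R%:E <= Nhat w.
  rewrite NE -(chi_sum (fun k => serving n a s t k w)).
  by apply: nneseries_lim_ge => *; exact: chi_ge0.
have DD : D%:R%:E <= Dhat w.
  apply: (@le_trans _ _ (\sum_(0 <= i < K) \sum_(0 <= l < K) (chi (bM i)
    * chi (bM (i.+1 + l)%N)))).
    rewrite big_mkord /D natr_sum -sumEFin; apply: lee_sum => i _.
    rewrite -(chi_sum (fun l => bM i && bM (i.+1 + l)%N)).
    by apply: lee_sum => l _; rewrite chi_and.
  apply: (@le_trans _ _ (\sum_(0 <= i < K) \sum_(0 <= l <oo)
     (chi (unfinished a s t i w) * chi (unfinished a s t (i.+1 + l) w)))).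
    by apply: lee_sum => i _; apply: nneseries_lim_ge => *;
      rewrite mule_ge0 ?chi_ge0.
  by apply: nneseries_lim_ge => *; exact: Di0.
have MN : (Num.min n%:R M%:R <= (N w)%:R :> R)%R.
  rewrite -natr_min minEnat ler_nat NE.
  exact: (in_service_ge_unfinished (s ^~ w) (a := fun i =>
    a i w) n_gt0 t_ge0 a0 tK).
have sqM : (M%:R ^+ 2 <= M%:R + 2 * D%:R :> R)%R.
  by rewrite -natrX -natrM -natrD ler_nat; exact: square_sum_bool.
have pp := positive_part_le (ler0n _ M) MN hN.
rewrite ME; apply: (@le_trans _ _
    ((N w)%:R + be * (M%:R + 2 * D%:R + (r + c) ^+ 2))%:E).
  rewrite -EFinM -EFinD lee_fin; apply: le_trans pp _.
  by rewrite lerD2l ler_wpM2l// lerD2r.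
rewrite EFinD EFinM; apply: leeD => //; apply: lee_wpmul2l;
  first by rewrite lee_fin.
rewrite !EFinD; apply: leeD => //; apply: leeD => //.
by rewrite EFinM; apply: lee_wpmul2l.
Qed.

(** [positive_part_le] in expectation, with [M] the number of jobs of the
    infinite-server queue, of mean [m] and second moment at most [m + m ^+ 2]. *)
Lemma transient_bound (f : Omega -> R) : (forall w, 0 <= f w)%R ->
  (forall w, f w <= Num.max ((N w)%:R - r) 0)%R ->
  \int[P]_w (f w)%:E <=
  mean_serving t + (be * (m + m ^+ 2 + (r + c) ^+ 2) - (r + al * m))%:E.
Proof.
move=> f0 fN; have be0 : (0 <= be)%R by rewrite invr_ge0 mulr_ge0// ltW.
have al0 : (0 <= al)%R by rewrite divr_ge0// ?addr_ge0// ?mulr_ge0// ltW.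
apply: ge0_integral_le_simple => [w|h hf]; first by rewrite lee_fin.
have mh : measurable_fun setT (fun w => (h w)%:E).
  by apply/measurable_EFinP; exact: measurable_funP.
have h0 w : 0 <= (h w)%:E by rewrite lee_fin; exact: fun_ge0.
rewrite EFinB addeA leeBrDr//.
have <- : \int[P]_w ((h w + r)%:E + al%:E * Mhat w) =
    \int[P]_w (h w)%:E + (r + al * m)%:E.
  under eq_integral do rewrite EFinD.
  rewrite ge0_integralD//; last 4 first.
  - by move=> w _; rewrite adde_ge0// lee_fin.
  - exact: emeasurable_funD.
  - by move=> w _; rewrite mule_ge0// lee_fin.
  - exact: emeasurable_funM.
  rewrite ge0_integralD//.
  rewrite ge0_integralZl_EFin// intM integral_probability_cst.
  by rewrite EFinD EFinM addeA.
apply: (@le_trans _ _ (\int[P]_w (Nhat w +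
    be%:E * (Mhat w + 2%:E * Dhat w + ((r + c) ^+ 2)%:E)))).
  have mr : measurable_fun setT (fun w => be%:E * (Mhat w + 2%:E * Dhat w + ((r
    + c) ^+ 2)%:E)).
    apply: emeasurable_funM => //; apply: emeasurable_funD => //.
    by apply: emeasurable_funD => //; exact: emeasurable_funM.
  apply: ae_ge0_le_integral => //.
  - move=> w _; apply: adde_ge0; first by rewrite EFinD adde_ge0// lee_fin.
    by rewrite mule_ge0// lee_fin.
  - apply: emeasurable_funD; last exact: emeasurable_funM.
    by apply/measurable_EFinP; apply: measurable_funD.
  - by move=> w _; rewrite adde_ge0// mule_ge0 ?lee_fin// !adde_ge0 ?mule_ge0//
      lee_fin sqr_ge0.
  - exact: emeasurable_funD.
  - apply: filterS pointwise => w H _; apply: H.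
    by apply: le_trans (fN w); rewrite -lee_fin.
have mD2 : measurable_fun setT (fun w => 2%:E * Dhat w) by exact: emeasurable_funM.
have mMD : measurable_fun setT (fun w => Mhat w + 2%:E * Dhat w).
  exact: emeasurable_funD.
have D20 w : 0 <= 2%:E * Dhat w by rewrite mule_ge0.
have MD0 w : 0 <= Mhat w + 2%:E * Dhat w by rewrite adde_ge0.
have MDg0 w : 0 <= Mhat w + 2%:E * Dhat w + ((r + c) ^+ 2)%:E.
  by rewrite adde_ge0// lee_fin sqr_ge0.
have mMDg : measurable_fun setT (fun w => Mhat w + 2%:E * Dhat w + ((r + c)
  ^+ 2)%:E).
  exact: emeasurable_funD.
rewrite ge0_integralD//; last 2 first.
- by move=> w _; rewrite mule_ge0// lee_fin.
- exact: emeasurable_funM.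
rewrite intN; apply: leeD => //.
rewrite ge0_integralZl_EFin// (EFinM be); apply: lee_wpmul2l;
  first by rewrite lee_fin.
rewrite ge0_integralD//; last by move=> w _; rewrite lee_fin sqr_ge0.
rewrite ge0_integralD// intM ge0_integralZl_EFin//.
rewrite integral_probability_cst !EFinD.
by apply: leeD => //; apply: leeD.
Qed.

End fixed_time.

End steady_state.

(** * The excess in the limit *)

(** At [m = r] and [delta = 0] both sides are [c / 2 - r]; this is where
    [c = sqrt r] balances the variance [r] against the square of the shift. *)
Lemma excess_algebra (R : realFieldType) (r c m delta : R) :
  (0 < c -> c * c = r -> 0 <= m -> r - delta <= m <= r ->
  (4 * c)^-1 * (m + m ^+ 2 + (r + c) ^+ 2) - (r + (r + c) / (2 * c) * m) <=
  c / 2 - r + (r + c) / (2 * c) * delta)%R.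
Proof.
move=> c0 c2 m0 /andP[rm mr].
have r0 : (0 <= r)%R by rewrite -c2 mulr_ge0// ltW.
have al0 : (0 < (r + c) / (2 * c))%R by rewrite divr_gt0 ?ltr_wpDl ?mulr_gt0.
have alm : ((r + c) / (2 * c) * (r - delta) <= (r + c) / (2 * c) * m)%R.
  by rewrite ler_pM2l.
have quad : ((4 * c)^-1 * (m + m ^+ 2 + (r + c) ^+ 2) <=
    (4 * c)^-1 * (r + r ^+ 2 + (r + c) ^+ 2))%R.
  rewrite ler_pM2l ?invr_gt0 ?mulr_gt0// lerD2r lerD//.
  by rewrite ler_pXn2r.
have balance : ((4 * c)^-1 * (r + r ^+ 2 + (r + c) ^+ 2) -
    (r + c) / (2 * c) * r = c / 2)%R.
  by rewrite -c2; field; rewrite gt_eqF.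
rewrite mulrBr in alm.
move: quad balance alm; move: (_ * (m + _ + _))%R (_ * (r + _ + _))%R => Q1 Q2.
move: (_ * m)%R (_ * r)%R (_ * delta)%R => am ar ad; lra.
Qed.

Section long_run.
Context d (Omega : measurableType d) (R : realType) (P : probability Omega R).
Context (n : nat) (a s : nat -> {RV P >-> R}) (lam ES : R)
  (nu sig : probability R R).
Hypothesis n_gt0 : (0 < n)%N.
Hypothesis lam_gt0 : (0 < lam)%R.
Hypothesis nuE : forall B : set R, measurable B -> nu B = exponential_prob lam B.
Hypothesis aE : forall k (B : set R), measurable B -> distribution P (a k) B = nu B.
Hypothesis sE : forall k (B : set R), measurable B -> distribution P (s k)
  B = sig B.
Hypothesis indep : independent_sequences a s.
Hypothesis ESE : \int[sig]_z (Num.max z 0)%:E = ES%:E.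
Notation mu := (@lebesgue_measure R).

Let trunc (t z : R) : \bar R := (Num.min (Num.max z 0) t)%:E.

Let mtrunc t : measurable_fun setT (trunc t).
Proof.
apply/measurable_EFinP; apply: measurable_minr => //.
exact: measurable_maxr.
Qed.

Let trunc0 t z : (0 <= t)%R -> 0 <= trunc t z.
Proof. by move=> t0; rewrite lee_fin le_min t0 le_max lexx orbT. Qed.

Let mmax0 : measurable_fun setT (fun z : R => (Num.max z 0)%:E).
Proof. by apply/measurable_EFinP; exact: measurable_maxr. Qed.

Let trunc_cvg : \int[sig]_z trunc k%:R z @[k --> \oo] --> ES%:E.
Proof.
rewrite -ESE.
have lim_trunc z : limn (fun k => trunc k%:R z) = (Num.max z 0)%:E.
  apply/cvg_lim => //; apply: cvg_near_cst.
  have max0 : (0 <= Num.max z 0)%R by rewrite le_max lexx orbT.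
  exists (Num.bound (Num.max z 0%R)) => // k /= zk; rewrite /trunc (min_idPl _)//.
  by rewrite (le_trans (ltW (archi_boundP max0)))// ler_nat.
have -> : \int[sig]_z (Num.max z 0)%:E = \int[sig]_z limn (fun k => trunc k%:R z).
  by apply: eq_integral => z _; rewrite lim_trunc.
apply: cvg_monotone_convergence => //.
- by move=> k z _; exact: trunc0.
- move=> z _ i j ij; rewrite lee_fin le_min !ge_min lexx/=.
  by rewrite ler_nat ij orbT.
Qed.

Lemma mean_unfinished_cvg (delta : R) : (0 < delta)%R ->
  exists2 t0, (0 <= t0)%R & forall t, (t0 <= t)%R ->
    exists2 m, mean_unfinished lam sig t = m%:E &
      (0 <= m)%R /\ (lam * ES - delta <= m <= lam * ES)%R.
Proof.
move=> delta0.
have dl : (0 < delta / lam)%R by rewrite divr_gt0.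
have near_ES : nbhs (ES%:E : \bar R) [set x | (ES - delta / lam)%:E < x].
  apply: open_nbhs_nbhs; split; first exact: open_ereal_gt_ereal.
  by rewrite /= lte_fin ltrBlDr ltrDl.
have [k _ /(_ k (leqnn k))/= Hk] := trunc_cvg near_ES.
exists k%:R => // t kt; have t0 : (0 <= t)%R by rewrite (le_trans _ kt).
have le_ES : \int[sig]_z trunc t z <= ES%:E.
  rewrite -ESE; apply: ge0_le_integral => //.
  - by move=> *; exact: trunc0.
  - by move=> z _; rewrite lee_fin ge_min lexx.
have ge_k : \int[sig]_z trunc k%:R z <= \int[sig]_z trunc t z.
  apply: ge0_le_integral => //.
  - by move=> *; exact: trunc0.
  - by move=> z _; rewrite lee_fin le_min !ge_min lexx/= kt orbT.
have int0 : 0 <= \int[sig]_z trunc t z by apply: integral_ge0 => *; exact: trunc0.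
have fin : \int[sig]_z trunc t z \is a fin_num.
  by rewrite ge0_fin_numE// (le_lt_trans le_ES)// ltry.
rewrite mean_unfinishedE// -/(trunc t) -(fineK fin) -EFinM.
set m := fine _ in le_ES ge_k *.
exists (lam * m)%R => //; split.
  by rewrite mulr_ge0 ?fine_ge0 ?(ltW lam_gt0).
have mES : (m <= ES)%R by rewrite -lee_fin /m fineK.
have mk : (ES - delta / lam < m)%R by rewrite -lte_fin /m fineK// (lt_le_trans Hk).
rewrite ler_pM2l// mES andbT.
have -> : (lam * ES - delta = lam * (ES - delta / lam))%R by field; rewrite gt_eqF.
by rewrite ler_pM2l// ltW.
Qed.

(** Otherwise the servers would do more than [lam * ES + eta] units of work per
    unit of time from [t0] on, in the long run more than arrives. *)
Lemma long_run_serving (eta t0 : R) : (0 < ES)%R -> (0 < eta)%R -> (0 <= t0)%R ->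
  exists2 t, (t0 <= t)%R & mean_serving n a s t < (lam * ES + eta)%:E.
Proof.
move=> ES0 eta0 t00; apply: contrapT => H.
have {}H t : (t0 <= t)%R -> (lam * ES + eta)%:E <= mean_serving n a s t.
  by move=> tt; rewrite leNgt; apply/negP => lt; apply: H; exists t.
set r := (lam * ES)%R in H *.
have r0 : (0 < r)%R by rewrite mulr_gt0.
(* chosen so that [(r + eta) * (tau - t0) - r * tau = eta] *)
pose tau := (t0 + (r * t0) / eta + 1)%R.
have tau_t0 : (t0 < tau)%R.
  have q0 : (0 <= r * t0 / eta)%R by apply: divr_ge0; [apply: mulr_ge0 => //|];
    exact: ltW.
  by rewrite /tau -addrA ltrDl ltr_wpDl.
have tau0 : (0 <= tau)%R by rewrite (le_trans t00)// ltW.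
have := busy_time_total n_gt0 lam_gt0 nuE aE sE indep ESE tau0.
apply/negP; rewrite -ltNge.
apply: (@lt_le_trans _ _ (\int[mu]_t ((r + eta)%:E * chi ((t0 <= t)%R && (t <=
  tau)%R)))).
  rewrite ge0_integralZl_EFin//; last 3 first.
  - by move=> *; exact: chi_ge0.
  - by apply: measurable_chi; apply: measurable_and; exact: measurable_fun_ler.
  - by rewrite addr_ge0// ltW.
  rewrite integral_chi; last by apply: measurable_and; exact: measurable_fun_ler.
  rewrite (_ : [set _ | _] = `[t0, tau]%classic); last first.
    by apply/seteqP; split=> x /=; rewrite in_itv/=.
  rewrite /= lebesgue_measure_itv/= lte_fin tau_t0 -EFinB -EFinM lte_fin.
  rewrite -subr_gt0 (_ : _ - _ = eta)%R// /tau /r; field.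
  by rewrite gt_eqF.
apply: ge0_le_integral => //.
- by move=> *; rewrite mule_ge0 ?chi_ge0// lee_fin addr_ge0// ltW.
- apply: emeasurable_funM => //; apply: measurable_chi; apply: measurable_and;
    exact: measurable_fun_ler.
- apply: emeasurable_funM; last exact: (measurable_mean_serving a s n_gt0).
  by apply: measurable_chi; apply: measurable_and; exact: measurable_fun_ler.
- move=> t _; rewrite !chiE; case: (leP t0 t) => /= tt; last first.
    by rewrite mule0 mule_ge0 ?mean_serving_ge0//; case: ifP.
  rewrite (le_trans t00 tt) /=; case: ifP => _; last by rewrite mule0 mul0e.
  by rewrite mule1 mul1e; exact: H.
Qed.

(** By [transient_bound], the mean excess at time [t] is at most
    [mean_serving t - r + c / 2] up to an error that vanishes as [t] grows, and
    [long_run_serving] gives arbitrarily late times at which [mean_serving t] is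
    almost at most [r]; a limit is bounded along those times. *)
Lemma limit_excess_le (f : R -> Omega -> R) (r c L : R) :
  (lam * ES)%R = r -> (0 < r)%R -> (0 < c)%R -> (c * c)%R = r ->
  (r <= n%:R)%R -> (forall t w, 0 <= f t w)%R ->
  (forall t w, f t w <= Num.max (#|` jobs_in_service (empty_system R n)
     (fun i => a i w) (s ^~ w) t|%fset%:R - r) 0)%R ->
  \int[P]_w (f t w)%:E @[t --> +oo%R] --> L%:E ->
  (L <= c / 2)%R.
Proof.
move=> rE r0 c0 c2 rn f0 fN fL.
rewrite leNgt; apply/negP => cL.
(* one [eta] each for the limit, for [mean_serving t] and for [m] *)
have [eta eta0 etaE] : exists2 eta : R, (0 < eta)%R & (L = c / 2 + 3 * eta)%R.
  by exists ((L - c / 2) / 3)%R; [rewrite divr_gt0// subr_gt0|field].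
have al0 : (0 < (r + c) / (2 * c))%R by rewrite divr_gt0 ?addr_gt0 ?mulr_gt0.
have ES0 : (0 < ES)%R by rewrite -(pmulr_rgt0 _ lam_gt0) rE.
have near_L : nbhs (L%:E : \bar R) [set x | (L - eta)%:E < x].
  apply: open_nbhs_nbhs; split; first exact: open_ereal_gt_ereal.
  by rewrite /= lte_fin ltrBlDr ltrDl.
have [M [_ HM]] := fL _ near_L.
have [t1 t10 Ht1] := mean_unfinished_cvg (divr_gt0 eta0 al0).
have T0 : (0 <= Num.max t1 (M + 1))%R by rewrite le_max t10.
have [t] := long_run_serving ES0 eta0 T0.
rewrite ge_max => /andP[t1t Mt] tser.
have [m mE [m0]] := Ht1 _ t1t; rewrite rE => rm.
have := @transient_bound _ _ _ P n a s lam nu sig n_gt0 lam_gt0 nuE aE sE indep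
  t r c m (le_trans t10 t1t) (ltW r0) rn c0 mE (f t) (f0 t) (fN t).
have /HM /= fLt : (M < t)%R by rewrite (lt_le_trans _ Mt)// ltrDl.
move=> /(lt_le_trans fLt) fS.
have finS : mean_serving n a s t \is a fin_num.
  by rewrite ge0_fin_numE ?mean_serving_ge0// (lt_trans tser)// ltry.
move: tser fS; rewrite -(fineK finS) -EFinD !lte_fin rE => Sr fS.
have := excess_algebra c0 c2 m0 rm.
have -> : ((r + c) / (2 * c) * (eta / ((r + c) / (2 * c))) = eta)%R.
  by rewrite mulrC divfK// gt_eqF.
move=> ub; move: (lt_le_trans fS (lerD (lexx _) ub)) Sr; rewrite etaE; lra.
Qed.
End long_run.

Section smoothed_count.
Context (R : realType) (n : nat).
Local Open Scope ring_scope.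

(** The number of nonzero coordinates is only lower semicontinuous.  These are
    continuous functions increasing to it, to which convergence in distribution
    applies. *)
Definition smoothed_count (k : nat) (v : 'rV[R]_n) : R :=
  \sum_(i < n) Num.min 1 (k%:R * `|v ord0 i|).

Definition smoothed_excess (r : R) (k : nat) (v : 'rV[R]_n) : R :=
  Num.max (smoothed_count k v - r) 0.

Lemma continuous_smoothed_excess r k : continuous (smoothed_excess r k).
Proof.
have cont_sum : continuous (smoothed_count k).
  rewrite /smoothed_count; elim: (index_enum _) => [|i l IH] v.
    under eq_fun do rewrite big_nil.
    exact: cst_continuous.
  under eq_fun do rewrite big_cons.
  apply: (@continuousD R R^o 'rV[R]_n (fun v : 'rV[R]_n =>
    Num.min 1 (k%:R * `|v ord0 i|)) (fun v : 'rV[R]_n =>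
      \sum_(j <- l) Num.min 1 (k%:R * `|v ord0 j|))); last exact: IH.
  apply: (@continuous_min R 'rV[R]_n (fun=> 1) (fun v : 'rV[R]_n =>
    k%:R * `|v ord0 i|)); first exact: cst_continuous.
  apply: (@continuousM R 'rV[R]_n (fun=> k%:R)
    (fun v : 'rV[R]_n =>`|v ord0 i|)); first exact: cst_continuous.
  apply: (@continuous_comp _ _ _ (fun v : 'rV[R]_n => v ord0 i) Num.norm);
    first exact: coord_continuous.
  exact: norm_continuous.
move=> v; apply: (@continuous_max R 'rV[R]_n (fun v =>
  smoothed_count k v - r) (fun=> 0)); last exact: cst_continuous.
by apply: (@continuousB R R^o 'rV[R]_n (smoothed_count k) (fun=> r));
  [exact: cont_sum|exact: cst_continuous].
Qed.

Lemma smoothed_excess_ge0 r k v : 0 <= smoothed_excess r k v.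
Proof. by rewrite le_max lexx orbT. Qed.

Lemma smoothed_count_le (k m : nat) (v : 'rV[R]_n) :
  (forall i, v ord0 i != 0 -> (i < m)%N) -> smoothed_count k v <= m%:R.
Proof.
move=> vm; apply: (@le_trans _ _ (\sum_(i < n) (i < m)%N)%:R).
  rewrite natr_sum; apply: ler_sum => i _; have := vm i.
  case: eqP => [-> _|_ ->//]; first by rewrite normr0 mulr0 ge_min ler0n orbT.
  by rewrite ge_min lexx.
rewrite ler_nat; have : (\sum_(i < n) (i < m)%N <= minn n m)%N.
  clear; elim: n => [|p IH]; first by rewrite big_ord0.
  rewrite big_ord_recr/=; move: IH; move: (\sum_(i < p) _)%N => S IH.
  by case: ltnP => /= pm; lia.
by move/leq_trans; apply; exact: geq_minr.
Qed.

Lemma smoothed_count_le_dim (k : nat) (v : 'rV[R]_n) : smoothed_count k v <= n%:R.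
Proof. by apply: smoothed_count_le => i _. Qed.

Lemma smoothed_count_nondecreasing (v : 'rV[R]_n) (i j : nat) : (i <= j)%N ->
  smoothed_count i v <= smoothed_count j v.
Proof.
move=> ij; apply: ler_sum => l _; rewrite le_min !ge_min lexx/=.
by rewrite ler_wpM2r ?ler_nat ?orbT.
Qed.

Lemma smoothed_count_eventually (v : 'rV[R]_n) :
  \forall k \near \oo, smoothed_count k v = (num_nonzero v)%:R.
Proof.
exists (\sum_(i < n) Num.bound `|v ord0 i|^-1)%N => // k /= Kk.
rewrite /smoothed_count /num_nonzero -sum1_card natr_sum [RHS]big_mkcond/=.
apply: eq_bigr => i _; rewrite inE; case: eqP => [->|/eqP vi] /=.
  by rewrite normr0 mulr0 (min_idPr ler01).
have vi0 : 0 < `|v ord0 i| by rewrite normr_gt0.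
rewrite (min_idPl _)// -ler_pdivrMr// mul1r.
have /ltW/le_trans : `|v ord0 i|^-1 < (Num.bound `|v ord0 i|^-1)%:R.
  by apply: archi_boundP; rewrite invr_ge0.
apply; rewrite ler_nat; apply: leq_trans Kk.
by rewrite (bigD1 i)//= leq_addr.
Qed.

End smoothed_count.

(** * Identification of the rates and conclusion *)

(** The mean is the integral of the tail, and [lam] times the tail is the
    density. *)
Lemma exponential_mean (R : realType) (lam : R) (nu : probability R R) :
  (0 < lam)%R ->
  (forall B : set R, measurable B -> nu B = exponential_prob lam B) ->
  \int[nu]_z (Num.max z 0)%:E = (lam^-1)%:E.
Proof.
move=> lam0 nuE.
have max0 (z : R) : (0 <= Num.max z 0)%R by rewrite le_max lexx orbT.
suff E : lam%:E * \int[nu]_z (Num.max z 0)%:E = 1.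
  have I0 : 0 <= \int[nu]_z (Num.max z 0)%:E.
    by apply: integral_ge0 => z _; rewrite lee_fin.
  move: E I0; case: (\int[nu]_z _) => [y| |]//.
    move=> [] /(congr1 (fun u => lam^-1 * u)%R);
      rewrite mulKf ?gt_eqF// mulr1 => ->.
    by [].
  by rewrite gt0_muley ?lte_fin.
rewrite -(integral_exponential_pdf lam0).
pose b (z u : R) := (0 <= u)%R && (u%:E < (Num.max z 0)%:E).
have mmax : measurable_fun setT (fun z : R => (Num.max z 0)%:E).
  by apply/measurable_EFinP; exact: measurable_maxr.
have mb : measurable_fun setT (fun p : R * measurableTypeR R =>
  chi (b p.1 p.2) : \bar R).
  apply: measurable_chi; apply: measurable_and;
    first by apply: measurable_fun_ler => //; exact: measurable_snd.
  apply: measurable_fun_lte; first by apply/measurable_EFinP; exact: measurable_snd.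
  exact: (measurableT_comp mmax measurable_fst).
transitivity (lam%:E * \int[nu]_z \int[lebesgue_measure]_u chi (b z u)).
  by congr (_ * _); apply: eq_integral => z _; rewrite integral_below// lee_fin.
rewrite tonelli//; last by move=> *; exact: chi_ge0.
rewrite -ge0_integralZl_EFin//; last 3 first.
- by move=> *; apply: integral_ge0 => *; exact: chi_ge0.
- apply: (@measurable_ge0_integral _ _ (measurableTypeR R) R R nu (fun u z =>
    chi (b z u))).
    have mswap : measurable_fun setT (fun p : measurableTypeR R * R => (p.2, p.1)).
      by apply: measurable_fun_pair; [exact: measurable_snd|exact: measurable_fst].
    exact: (measurableT_comp mb mswap).
  by move=> *; exact: chi_ge0.
- exact: ltW.
apply: eq_integral => u _.
case: (leP 0%R u) => u0; last first.
  rewrite lt0_exponential_pdf// integral0_eq ?mule0// => z _.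
  by rewrite /b leNgt u0.
have -> : \int[nu]_z chi (b z u) = nu (~` [set z | (z <= u)%R]).
  rewrite integral_chi; last first.
    apply: measurable_and => //; apply: measurable_fun_lte => //.
  congr (nu _); apply/seteqP; split=> z /=; rewrite /b u0/= lte_fin lt_max
    (ltNge u 0%R) u0 orbF ltNge.
    by move/negP.
  by move/negP.
have mle : measurable [set z : R | (z <= u)%R].
  by apply: measurable_boolset; exact: measurable_fun_ler.
have := exponential_cdf_pdf nuE u; rewrite u0 chiE mule1.
rewrite probability_setC//.
have /fineK <- : nu [set z | (z <= u)%R] \is a fin_num by exact: fin_num_measure.
rewrite -EFinB -!EFinM -EFinD => -[H]; congr EFin.
by rewrite mulrBr mulr1 -{1}H addrAC subrr add0r.
Qed.

Lemma expectation_positive_part d (T : measurableType d) (R : realType)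
    (P : probability T R) (X : {RV P >-> R}) : {ae P, forall w, 0 <= X w}%R ->
  'E_P[X] = \int[distribution P X]_z (Num.max z 0)%:E.
Proof.
move=> X0; have mmax : measurable_fun setT (fun z : R => (Num.max z 0)%:E).
  by apply/measurable_EFinP; exact: measurable_maxr.
rewrite ge0_integral_distribution//; last first.
  by move=> z; rewrite lee_fin le_max lexx orbT.
rewrite expectation_def; apply: ae_eq_integral => //.
- by apply/measurable_EFinP; exact: measurable_funP.
- by apply: (measurableT_comp mmax); exact: measurable_funP.
- by apply: filterS X0 => w X0 _ /=; rewrite (max_idPl X0).
Qed.

Section steady_vector.
Context d (T : measurableType d) (R : realType) (P : probability T R) (n : nat).
Variable W : 'I_n -> {RV P >-> R}.

Lemma measurable_smoothed_excess r k :
  measurable_fun setT (fun w => smoothed_excess r k (random_vector W w)).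
Proof.
apply: measurable_maxr => //; apply: measurable_funB => //.
apply: measurable_sum => i; apply: measurable_minr => //;
  apply: measurable_funM => //.
under eq_fun do rewrite mxE.
by apply: measurableT_comp => //; exact: measurable_funP.
Qed.

Lemma measurable_num_nonzero :
  measurable_fun setT (fun w => (num_nonzero (random_vector W w))%:R : R).
Proof.
apply: (@measurable_fun_cvg _ _ _ _ (fun k w =>
  smoothed_count k (random_vector W w))).
  move=> k; apply: measurable_sum => i; apply: measurable_minr => //;
    apply: measurable_funM => //.
  under eq_fun do rewrite mxE.
  by apply: measurableT_comp => //; exact: measurable_funP.
by move=> w _; apply: cvg_near_cst; exact: smoothed_count_eventually.
Qed.

(** Monotone convergence in [k] gives the mean excess over [r] of the number of
    nonzero coordinates; the rest is Markov's inequality. *)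
Lemma num_nonzero_tail (r x c : R) : (0 < x)%R -> (0 < c)%R ->
  (forall k,
    \int[P]_w (smoothed_excess r k (random_vector W w))%:E <= (c / 2)%:E) ->
  P [set w | (r + x * c <= (num_nonzero (random_vector W w))%:R)%R] <=
  (1 / (2 * x))%:E.
Proof.
move=> x0 c0 Hk.
pose B w : bool := (r + x * c <= (num_nonzero (random_vector W w))%:R)%R.
have mB : measurable_fun setT B.
  by apply: measurable_fun_ler => //; exact: measurable_num_nonzero.
pose e w := (Num.max ((num_nonzero (random_vector W w))%:R - r) 0)%R.
have me k : measurable_fun setT (fun w => (smoothed_excess r k (random_vector W
  w))%:E).
  by apply/measurable_EFinP; exact: measurable_smoothed_excess.
have lim_e w : limn (fun k => (smoothed_excess r k (random_vector W w))%:E)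
  = (e w)%:E.
  apply/cvg_lim => //; apply: cvg_near_cst.
  by apply: filterS (smoothed_count_eventually (random_vector W w)) => k /= E;
    rewrite /smoothed_excess E.
have int_e : \int[P]_w (e w)%:E <= (c / 2)%:E.
  under eq_integral do rewrite -lim_e.
  have nd w : setT w -> nondecreasing_seq
      (fun k => (smoothed_excess r k (random_vector W w))%:E).
    move=> _ i j ij; rewrite lee_fin le_max2// lerD2r.
    exact: smoothed_count_nondecreasing.
  rewrite monotone_convergence//; last first.
    by move=> k w _; rewrite lee_fin smoothed_excess_ge0.
  apply: lime_le; last by near=> k; exact: Hk.
  apply: ereal_nondecreasing_is_cvgn => i j ij; apply: ge0_le_integral => //.
  - by move=> w _; rewrite lee_fin smoothed_excess_ge0.
  - by move=> w _; exact: (nd w I i j ij).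
have : (x * c)%:E * P [set w | B w] <= (c / 2)%:E.
  apply: le_trans int_e; rewrite -integral_chi// -ge0_integralZl_EFin//;
    last 3 first.
  - by move=> *; exact: chi_ge0.
  - exact: measurable_chi.
  - by rewrite mulr_ge0// ltW.
  apply: ge0_le_integral => //.
  - by move=> w _; rewrite mule_ge0 ?chi_ge0// lee_fin mulr_ge0// ltW.
  - by apply: emeasurable_funM => //; exact: measurable_chi.
  - apply/measurable_EFinP; apply: measurable_maxr => //.
    by apply: measurable_funB => //; exact: measurable_num_nonzero.
  - move=> w _; rewrite chiE; case: ifP => [Bw|_].
      by rewrite mule1 lee_fin le_max lerBrDl; apply/orP; left.
    by rewrite mule0 lee_fin le_max lexx orbT.
have /fineK <- : P [set w | B w] \is a fin_num.
  by rewrite fin_num_measure//; exact: measurable_boolset.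
rewrite -EFinM !lee_fin => H.
rewrite ler_pdivlMr ?mulr_gt0// -(ler_pM2r c0) mul1r.
have -> : (fine (P [set w | B w]) * (2 * x) * c = 2 * (x * c * fine (P [set w |
  B w])))%R.
  by ring.
by move: H; move: (x * c * _)%R => q; lra.
Unshelve. all: by end_near. Qed.

End steady_vector.

Local Close Scope ereal_scope.

Theorem theorem7 (R : realType) (n : nat)
    (* the probability space carrying the primitives of the queue *)
    (d : measure_display) (Omega : measurableType d) (P : probability Omega R)
    (A S : {RV P >-> R}) (interarrival service : nat -> {RV P >-> R})
    (* the probability spaces carrying Q(oo) and W_service(oo) *)
    (dQ : measure_display) (OmegaQ : measurableType dQ)
    (PQ : probability OmegaQ R) (Qoo : {RV PQ >-> nat})
    (dW : measure_display) (OmegaW : measurableType dW)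
    (PW : probability OmegaW R) (Woo : 'I_n -> {RV PW >-> R}) :
  (1 <= n)%N ->
  exponentially_distributed A ->
  {ae P, forall w, 0 <= S w} ->
  (0 < 'E_P[S])%E ->
  ('E_P[S] < +oo)%E ->
  (forall k, same_law (interarrival k) A) ->
  (forall k, same_law (service k) S) ->
  independent_sequences interarrival service ->
  rate P A < n%:R * rate P S ->
  steady_state_num_in_system n interarrival service Qoo ->
  steady_state_service_vector interarrival service Woo ->
  forall x : R, 0 < x ->
    x <= (n%:R - rate P A / rate P S) / Num.sqrt (rate P A / rate P S) ->
    (PW [set w | (rate P A / rate P S + x * Num.sqrt (rate P A / rate P S)
                    <= (num_nonzero (random_vector Woo w))%:R)%R]
     <= (1 / (2 * x))%:E)%E.
Proof.
move=> n0 [lam lam0 AE] S0 ES0 ESy Ia Is ind stable _ Wss x x0 _.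
pose nu : probability R R := distribution P A.
pose sig : probability R R := distribution P S.
pose ES := fine ('E_P[S])%E.
have ESr : (0 < ES)%R by rewrite fine_gt0// ES0 ESy.
have ESE : (\int[sig]_z (Num.max z 0)%:E = ES%:E)%E.
  rewrite -(expectation_positive_part S0) /ES fineK//.
  by rewrite ge0_fin_numE// ltW.
have A0 : {ae P, forall w, 0 <= A w}.
  have := @interarrival_ge0 _ _ _ P (fun=> A) lam nu AE (fun _ _ _ => erefl).
  by apply: filterS => w /(_ 0%N).
have rateA : rate P A = lam.
  rewrite /rate (expectation_positive_part A0).
  by rewrite (exponential_mean (nu := nu) lam0 AE) invrK.
have rateS : rate P S = ES^-1 by [].
set r := rate P A / rate P S; set c := Num.sqrt r.
have rE : lam * ES = r by rewrite /r rateA rateS invrK.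
have r0 : 0 < r by rewrite -rE mulr_gt0.
have c0 : 0 < c by rewrite sqrtr_gt0.
have c2 : c * c = r by rewrite -expr2 sqr_sqrtr// ltW.
have rn : r <= n%:R.
  by rewrite -rE -ler_pdivlMr// ltW// -rateS -rateA.
apply: (num_nonzero_tail x0 c0) => k.
pose f t w := smoothed_excess r k (service_vector (empty_system R n)
  (fun i => interarrival i w) (service ^~ w) t).
have excess_le_n v : `|@smoothed_excess R n r k v| <= n%:R.
  rewrite ger0_norm ?smoothed_excess_ge0// ge_max ler0n andbT lerBlDr.
  by rewrite (le_trans (smoothed_count_le_dim k v))// lerDl ltW.
have := Wss (empty_system R n) (smoothed_excess r k)
  (@continuous_smoothed_excess R n r k) (ex_intro _ n%:R excess_le_n).
rewrite unlock.
have me := measurable_smoothed_excess Woo r k.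
have fin : (\int[PW]_w (smoothed_excess r k (random_vector Woo w))%:E \is a
  fin_num)%E.
  rewrite ge0_fin_numE; last first.
    by apply: integral_ge0 => w _; rewrite lee_fin smoothed_excess_ge0.
  apply: (@le_lt_trans _ _ n%:R%:E); last exact: ltry.
  rewrite -[leRHS](integral_probability_cst PW); apply: ge0_le_integral => //.
  - by move=> w _; rewrite lee_fin smoothed_excess_ge0.
  - exact/measurable_EFinP.
  - by move=> w _; rewrite lee_fin (le_trans (ler_norm _)).
rewrite -(fineK fin) => lim_f; rewrite lee_fin.
apply: (limit_excess_le n0 lam0 (nu := nu) AE _ _ ind ESE (f := f)
  rE r0 c0 c2 rn) => //.
- by move=> t w; exact: smoothed_excess_ge0.
- move=> t w; rewrite le_max2// lerD2r; apply: smoothed_count_le => i.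
  exact: nonzero_service_vector.
Qed.
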